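(* Let $\phi\colon G(1,2) \to [0,1]$ be an upper semi-continuous function. Then there exists a compact set $F \subseteq \mathbb{R}^2$ with $\dim_\mathrm{A} F = 0$ such that $\dim_\mathrm{A} \pi F = \phi(\pi)$ for all $\pi \in G(1,2)$.
   Context: $G(1,2)$ denotes the Grassmannian of one-dimensional linear subspaces (lines through the origin) of $\mathbb{R}^2$, with its usual topology (e.g. given by the angle between lines); a subspace $\pi \in G(1,2)$ is identified with the orthogonal projection of $\mathbb{R}^2$ onto it, and $\pi F$ is the orthogonal projection of $F$ onto $\pi$. For a non-empty bounded set $E$ and $r>0$, $N_r(E)$ is the smallest number of open sets of diameter at most $r$ needed to cover $E$. The Assouad dimension of a non-empty set $F \subseteq \mathbb{R}^d$ is $\dim_\mathrm{A} F = \inf\{ s \ge 0 : \exists C>0\ \forall R>0\ \forall r\in(0,R),\ \sup_{x\in F} N_r(B(x,R)\cap F) \le C (R/r)^s\}$, where $B(x,R)$ is the closed ball of radius $R$ centred at $x$. *)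

(* Defs.v *)
From HB Require Import structures.
From mathcomp Require Import all_boot all_order all_algebra.
From mathcomp Require Import all_classical all_reals all_analysis.
Set Implicit Arguments. Unset Strict Implicit. Unset Printing Implicit Defensive.
Import Order.TTheory GRing.Theory Num.Theory.
Import numFieldNormedType.Exports.
Local Open Scope classical_set_scope.
Local Open Scope ring_scope.

Section Defs.
Variable R : realType.
Notation P2 := (R * R)%type.

Definition edist (x y : P2) : R :=
  Num.sqrt ((x.1 - y.1) ^+ 2 + (x.2 - y.2) ^+ 2).

Definition cball2 (x : P2) (r : R) : set P2 := [set y | edist x y <= r].

Definition diam_le (U : set P2) (r : R) : Prop :=
  forall x y, U x -> U y -> edist x y <= r.

Definition coverable (E : set P2) (r : R) (n : nat) : Prop :=
  exists U : nat -> set P2,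
    (forall i, (i < n)%N -> open (U i) /\ diam_le (U i) r) /\
    E `<=` \bigcup_(i in [set i | (i < n)%N]) U i.

Definition Ncover (E : set P2) (r : R) : R :=
  inf [set (n%:R : R) | n in [set n | coverable E r n]].

(* Assouad dimension (extended real; +oo if no admissible exponent) *)
Definition assouad_dim (F : set P2) : \bar R :=
  ereal_inf [set (s%:E) | s in
    [set s : R | 0 <= s /\
      exists C : R, 0 < C /\
        forall Rr r : R, 0 < Rr -> 0 < r -> r < Rr ->
          forall x, F x -> Ncover (cball2 x Rr `&` F) r <= C * (Rr / r) `^ s]].

(* The line pi_theta in G(1,2) spanned by (cos theta, sin theta), and the
   orthogonal projection of F onto it (as a subset of R^2). *)
Definition proj_line (theta : R) (F : set P2) : set P2 :=
  [set (((x.1 * cos theta + x.2 * sin theta) * cos theta),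
        ((x.1 * cos theta + x.2 * sin theta) * sin theta)) | x in F].

(* A function on G(1,2), presented via the angle parametrisation
   theta |-> span (cos theta, sin theta): it must be pi-periodic
   (the parametrisation identifies theta and theta + pi). *)
Definition on_G12 (phi : R -> R) : Prop := forall t, phi (t + pi) = phi t.

(* upper semicontinuity of phi (for pi-periodic phi this is exactly upper
   semicontinuity of the induced function on G(1,2) = R / pi Z) *)
Definition upper_semicont (phi : R -> R) : Prop :=
  forall t (e : R), 0 < e -> \forall u \near t, phi u < phi t + e.

End Defs.

(* Main.v *)
Require Import Defs.
From HB Require Import structures.
From mathcomp Require Import all_boot all_order all_algebra.
From mathcomp Require Import all_classical all_reals all_analysis.
From mathcomp Require Import ring lra zify.
Import Order.TTheory GRing.Theory Num.Theory.
Import numFieldNormedType.Exports.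
Local Open Scope classical_set_scope.
Local Open Scope ring_scope.

(* A finite lacunary set has small Assouad dimension with uniform constants, yet
   its projection along the lacunary coordinate can be any finite set, for
   instance a level n Cantor set of dimension s.  Such a cluster looks
   s-dimensional only in a tiny interval of directions around its own angle: at
   angular distance at least 1/n the lacunary coordinate dominates, and in between
   the projection splits into a perturbed piece of the Cantor set, a lacunary set
   and at most one point.  For each n, finitely many clusters suffice to be seen
   from every direction.  All of them are placed at geometrically decreasing
   distances from the origin along a parabola, so that the union is again lacunary
   in the plane and, up to finitely many clusters, in every projection.  Choosing
   for the cluster of angle a the supremum of phi over the directions within 1/n
   of a (and at least 1/n) gives dimension at least phi in every direction, and at
   most phi by upper semicontinuity. *)

(** * Packing bounds *)

Section Packing.
Context {R : realType} {T : eqType}.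
Implicit Types (d : T -> T -> R) (E : set T) (S : seq T).

Definition spaced d (r D : R) S :=
  uniq S /\ {in S &, forall x y, x != y -> r < d x y <= D}.

(** Packing numbers stand in for covering numbers because they pass to subsets, unions and
    bi-Lipschitz images with explicit constants. Keeping [C] in the statement makes uniformity over
    all clusters expressible. *)
Definition packing_bound d E (C s : R) := forall (r D : R) S,
  0 < r -> r <= D -> spaced d r D S -> (forall x, x \in S -> E x) ->
  (size S)%:R <= C * (D / r) `^ s.

(** Distinct points may lie at distance 0, as happens for distances measured after projection. *)
Definition pseudometric d :=
  (forall x y, d x y = d y x) /\ (forall x y z, d x z <= d x y + d y z).

Lemma spaced_sub d r D (S S' : seq T) :
  uniq S' -> {subset S' <= S} -> spaced d r D S -> spaced d r D S'.
Proof.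
move=> uS' sS [_ dS]; split=> // x y xS yS.
by apply: dS; exact: sS.
Qed.

Lemma ratio_ge1 (r D : R) : 0 < r -> r <= D -> 1 <= D / r.
Proof. by move=> r0 rD; rewrite ler_pdivlMr// mul1r. Qed.

Lemma powR_ge1 (x s : R) : 1 <= x -> 0 <= s -> 1 <= x `^ s.
Proof. by move=> x1 s0; rewrite -(powRr0 x) ler_powR. Qed.

Lemma packing_bound_sub d E E' C s :
  E `<=` E' -> packing_bound d E' C s -> packing_bound d E C s.
Proof. by move=> EE' h r D S r0 rD sS SE; apply: (h) => // x /SE /EE'. Qed.

Lemma packing_boundS d E C C' s s' : 0 <= C -> C <= C' -> s <= s' ->
  packing_bound d E C s -> packing_bound d E C' s'.
Proof.
move=> C0 CC' ss' h r D S r0 rD sS SE; apply: le_trans (h _ _ _ r0 rD sS SE) _.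
by apply: ler_pM => //; [exact: powR_ge0|rewrite ler_powR// ratio_ge1].
Qed.

Lemma packing_boundU d E E' C C' s : packing_bound d E C s ->
  packing_bound d E' C' s -> packing_bound d (E `|` E') (C + C') s.
Proof.
move=> h h' r D S r0 rD sS SE.
pose a := [pred x | `[< E x >]].
have [uS _] := sS.
rewrite -(count_predC a S) natrD mulrDl -!size_filter lerD//.
  apply: h => //; last by move=> x; rewrite mem_filter => /andP[/asboolP].
  apply: spaced_sub sS; first exact: filter_uniq.
  by move=> x; rewrite mem_filter => /andP[].
apply: h' => //.
  apply: spaced_sub sS; first exact: filter_uniq.
  by move=> x; rewrite mem_filter => /andP[].
move=> x; rewrite mem_filter => /andP[/= /negP nEx /SE[]// Ex].
by case: nEx; apply/asboolP.
Qed.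

Lemma packing_bound_seq d (S0 : seq T) :
  packing_bound d [set` S0] (size S0)%:R 0.
Proof.
move=> r D S r0 rD [uS _] SE.
by rewrite powRr0 mulr1 ler_nat uniq_leq_size.
Qed.

Lemma size_fibers (k : T -> nat) (S : seq T) (B : R) (i0 n : nat) :
  (forall x, x \in S -> i0 <= k x < i0 + n)%N ->
  (forall i, (size [seq x <- S | k x == i])%:R <= B) ->
  (size S)%:R <= n%:R * B.
Proof.
elim: n S => [|n IH] S kS hB.
  have -> : S = [::] by case: S kS {hB} => // x S /(_ x); rewrite mem_head; lia.
  by rewrite mul0r.
rewrite -(count_predC [pred x | k x == (i0 + n)%N] S) natrD -!size_filter.
rewrite -natr1 mulrDl mul1r [leRHS]addrC lerD//.
  exact: hB.
apply: IH => [x|i].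
  by rewrite mem_filter => /andP[/= /eqP h /kS]; lia.
apply: le_trans (hB i); rewrite ler_nat -filter_predI !size_filter.
by apply: sub_count => x /= /andP[].
Qed.

Lemma nat_seq_min_max (s : seq nat) : s != [::] ->
  exists i j, [/\ i \in s, j \in s & forall x, x \in s -> (i <= x <= j)%N].
Proof.
elim: s => // a [|b s] IH _.
  by exists a, a; split; rewrite ?mem_head// => x; rewrite inE => /eqP ->; lia.
have [//|i [j [iS jS h]]] := IH.
exists (minn a i), (maxn a j); split.
- by rewrite /minn; case: ifP; rewrite in_cons ?eqxx// iS orbT.
- by rewrite /maxn; case: ifP; rewrite in_cons ?eqxx// jS orbT.
- by move=> x; rewrite in_cons => /orP[/eqP->|/h]; lia.
Qed.

(** Serves to absorb the number of visible annuli, which is logarithmic in [X], into an arbitrarily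
    small power of [X]. It comes from [1 + x <= expR x] at [x = n * e * ln 16]. *)
Lemma log_le_powR (e : R) : 0 < e -> exists2 K : R, 0 < K &
  forall (n : nat) (X : R), 1 <= X -> 16 ^+ n <= 12 * X ->
    n.+1%:R <= K * X `^ e.
Proof.
move=> e0.
have l0 : 0 < ln (16 : R) by rewrite ln_gt0//; lra.
have el0 : 0 < e * ln 16 by rewrite mulr_gt0.
exists (12 `^ e / (e * ln 16) + 1).
  by rewrite addr_gt0// divr_gt0// powR_gt0.
move=> n X X1 hn.
have X0 : 0 <= X by lra.
have Xe : 1 <= X `^ e by rewrite powR_ge1// ltW.
rewrite -natr1 mulrDl mul1r lerD//.
rewrite mulrAC ler_pdivlMr// -powRM//.
apply: le_trans (_ : (16 ^+ n) `^ e <= _).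
  rewrite -powR_mulrn; last by lra.
  rewrite -powRrM /powR ifF; last by apply/eqP; lra.
  apply: le_trans (expR_ge1Dx _).
  lra.
rewrite ge0_ler_powR ?nnegrE ?exprn_ge0 ?mulr_ge0//; [exact: ltW|lra..].
Qed.

(* Since consecutive annuli shrink geometrically, a set of diameter at most D
   meets either one of them or only annuli of radius at most 3 D; at scale r
   only O(log (D / r)) of the latter are visible. *)
Lemma packing_bound_annuli (C s e : R) : 0 <= C -> 0 <= s -> 0 < e ->
  exists2 C' : R, 0 <= C' &
  forall d (o : T) (E : nat -> set T) (a : nat -> R), pseudometric d ->
    (forall k, 0 <= a k) -> (forall k, 16 * a k.+1 <= a k) ->
    (forall k x, E k x -> a k / 2 <= d o x <= 2 * a k) ->
    (forall k, packing_bound d (E k) C s) ->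
    packing_bound d (\bigcup_k E k) C' (s + e).
Proof.
move=> C0 s0 e0; have [K K0 hK] := log_le_powR e e0.
exists (K * C + 1) => [|d o E a [dC dT] a0 a16 aE hE r D S r0 rD sS SE].
  by rewrite addr_ge0// mulr_ge0// ltW.
have X1 := ratio_ge1 r D r0 rD.
have [uS dS] := sS.
have /choice[k kE] : forall x, exists k : nat, x \in S -> E k x.
  move=> x.
  have [xS|] := boolP (x \in S); last by exists 0%N.
  by have [i _ Ei] := SE _ xS; exists i.
have a16n i n : 16 ^+ n * a (i + n)%N <= a i.
  elim: n => [|n IH]; first by rewrite addn0 mul1r.
  apply: le_trans IH; rewrite exprSr -mulrA ler_pM2l ?exprn_gt0//.
  by rewrite addnS.
have Sd x : x \in S -> a (k x) / 2 <= d o x <= 2 * a (k x).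
  by move=> /kE /aE.
pose b := [pred x | a (k x) <= r / 4].
have -> : (K * C + 1) * (D / r) `^ (s + e) =
    (D / r) `^ (s + e) + K * (D / r) `^ e * (C * (D / r) `^ s).
  rewrite powRD; last by apply/implyP => _; rewrite gt_eqF//; lra.
  ring.
rewrite -(count_predC b S) natrD -!size_filter lerD//.
  (* All points in annuli of radius at most [r / 4] are within [r / 2] of [o], hence within [r] of
     each other: at most one of them is in [S]. *)
  apply: (@le_trans _ _ 1); last by rewrite powR_ge1// addr_ge0// ltW.
  rewrite lern1.
  have := filter_uniq b uS.
  have : {subset [seq x <- S | b x] <= [predI b & mem S]}.
    by move=> x; rewrite mem_filter.
  case: [seq x <- S | b x] => [|x [|y s']]//= sb /andP[nx _].
  have /andP[/= bx xS] := sb x (mem_head _ _).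
  have /andP[/= bY yS] : [predI b & mem S] y.
    by apply: sb; rewrite !in_cons eqxx orbT.
  have xy : x != y by apply: contraNneq nx => ->; rewrite mem_head.
  have hx : a (k x) <= r / 4 by exact: bx.
  have hy : a (k y) <= r / 4 by exact: bY.
  have /andP[h1 _] := dS x y xS yS xy.
  have /andP[_ h2] := Sd x xS; have /andP[_ h3] := Sd y yS.
  have := dT x o y; rewrite (dC x o) => h4.
  by exfalso; lra.
set S2 := [seq x <- S | _].
have S2S x : x \in S2 -> x \in S /\ r / 4 < a (k x).
  by rewrite mem_filter => /andP[/=]; rewrite -ltNge.
have uS2 : uniq S2 by exact: filter_uniq.
clearbody S2.
have [->|] := eqVneq S2 [::].
  by rewrite !mulr_ge0// ?powR_ge0// ltW.
case: S2 S2S uS2 => // x0 s2; set S2 := x0 :: s2 => S2S uS2 _.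
have [//|i [j [/mapP[x xS ix] /mapP[y yS jy] hij]]] := nat_seq_min_max (map k S2).
have kij z : z \in S2 -> (i <= k z <= j)%N by move=> zS; apply: hij; exact: map_f.
have ij : (i <= j)%N by have /andP[+ _] := kij _ yS; rewrite -jy.
(* If [i < j], points in the outermost and innermost visible annuli are at most [D] apart while
   [2 * a j <= a i / 8], so [a i <= 3 * D]. As [a j > r / 4], this bounds the number of annuli
   between them. *)
have hn : 16 ^+ (j - i) <= 12 * (D / r).
  have [<-|nij] := eqVneq i j; first by rewrite subnn expr0; lra.
  have xy : x != y by apply: contraNneq nij; rewrite ix jy => ->.
  have [xS' _] := S2S _ xS; have [yS' ry] := S2S _ yS.
  have h1 := a16n i (j - i)%N; rewrite subnKC// in h1.
  have h2 := a16n i.+1 (j - i.+1)%N; rewrite subnKC in h2; last by rewrite ltn_neqAle nij.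
  have h3 : a j <= a i.+1.
    apply: le_trans h2; apply: ler_peMl => //; apply: exprn_ege1; lra.
  have h4 := a16 i.
  have /andP[h6 _] := Sd x xS'; have /andP[_ h7] := Sd y yS'.
  rewrite -ix in h6; rewrite -jy in h7.
  have := dT o y x; rewrite (dC y x) => hT.
  have /andP[_ hD] := dS x y xS' yS' xy.
  have h5 : 16 ^+ (j - i) * (r / 4) <= 3 * D.
    apply: le_trans (_ : a i <= _); last by lra.
    apply: le_trans h1; rewrite ler_pM2l ?exprn_gt0//.
    by rewrite jy ltW.
  rewrite mulrA ler_pdivlMr//; lra.
apply: le_trans (_ : (j - i).+1%:R * (C * (D / r) `^ s) <= _).
  apply: (size_fibers k _ _ i) => [z /kij|l]; first by rewrite addnS subnKC.
  apply: (hE l _ D) => //.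
    apply: spaced_sub sS; first exact: filter_uniq.
    by move=> z; rewrite mem_filter => /andP[_ /S2S[]].
  by move=> z; rewrite mem_filter => /andP[/eqP <- /S2S[/kE]].
by rewrite ler_wpM2r ?hK// mulr_ge0// powR_ge0.
Qed.

(** Annuli with at most one point each have exponent 0, so only the loss [e] remains; the constant
    depends on [e] alone. *)
Lemma packing_bound_lacunary (e : R) : 0 < e ->
  exists2 C : R, 0 <= C &
  forall d (o : T) (q : nat -> T) (J : set nat) (a : nat -> R), pseudometric d ->
    (forall k, 0 <= a k) -> (forall k, 16 * a k.+1 <= a k) ->
    (forall k, J k -> a k / 2 <= d o (q k) <= 2 * a k) ->
    packing_bound d (q @` J) C e.
Proof.
move=> e0; have [C C0 hC] := packing_bound_annuli 1 0 e ler01 (lexx 0) e0.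
exists C => // d o q J a dP a0 a16 aJ; rewrite -(add0r e).
apply: (@packing_bound_sub _ _ (\bigcup_k [set y | J k /\ y = q k])).
  by move=> _ [k Jk <-]; exists k.
apply: (hC _ o _ a) => // [k y [/aJ + ->]//|k].
apply: (@packing_bound_sub _ _ [set` [:: q k]]); last exact: packing_bound_seq.
by move=> y [_ ->] /=; rewrite mem_head.
Qed.

End Packing.

(** * Cantor sets of prescribed dimension *)

Section Spread.
Context {R : realType}.
Variable lam : R.

(** Halving is not structural, hence the fuel; every fuel at least [n] gives the same value. *)
Fixpoint spread_rec (fuel n : nat) : R :=
  if fuel is f.+1 then lam * spread_rec f n./2 + (odd n)%:R else 0.

(* The binary digits of [n] read in base [lam]: for [lam = 2 `^ (1 / s)] the
   values at [n < 2 ^ m] are the endpoints of a level [m] self-similar Cantor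
   set of dimension [s]. *)
Definition spread (n : nat) : R := spread_rec n n.

Lemma spreadE n : spread n = lam * spread n./2 + (odd n)%:R.
Proof.
have fuelE : forall m f g, (m <= f)%N -> (m <= g)%N ->
    spread_rec f m = spread_rec g m.
  have rec0 f : spread_rec f 0 = 0.
    by elim: f => //= f ->; rewrite mulr0 addr0.
  move=> m f; elim: f m => [|f IH] m [|g]; rewrite ?leqn0 => hf hg.
  - by [].
  - by rewrite (eqP hf) rec0.
  - by move: hg; rewrite ?leqn0 => /eqP ->; rewrite rec0.
  - by rewrite /= (IH _ g)//; lia.
rewrite /spread; case: n => [|n]; first by rewrite /= mulr0 addr0.
by rewrite [LHS]/= (fuelE _ n n.+1./2)//; lia.
Qed.

Hypothesis lam2 : (2 : R) <= lam.

Lemma spread0 : spread 0 = 0. Proof. by []. Qed.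

Lemma spread1 : spread 1 = 1. Proof. by rewrite spreadE /= spread0 mulr0 add0r. Qed.

Lemma spread_ge0 n : 0 <= spread n.
Proof.
have l2 := lam2.
elim/ltn_ind: n => -[|n] IH //.
have h := IH n.+1./2 ltac:(lia).
rewrite spreadE addr_ge0// mulr_ge0//. lra.
Qed.

(** Adding in binary, two equal digits 1 are carried to one digit of the next place, which is worth
    [lam >= 2] times as much, so carries can only increase the value. *)
Lemma spread_superadd i j : spread i + spread j <= spread (i + j).
Proof.
have l2 := lam2.
have [n] := ubnP (i + j); elim: n i j => // n IH i j ijn.
have [->|i0] := eqVneq i 0%N; first by rewrite spread0 add0r add0n.
have [->|j0] := eqVneq j 0%N; first by rewrite spread0 addr0 addn0.
rewrite (spreadE i) (spreadE j) (spreadE (i + j)) oddD.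
have h1 := IH i./2 j./2 ltac:(lia).
have hh : (i + j)./2 = (i./2 + j./2 + (odd i && odd j))%N by lia.
rewrite hh; case oi: (odd i) hh; case oj: (odd j) => /= hh; rewrite ?addn0.
- have h2 : spread (i./2 + j./2) + 1 <= spread (i./2 + j./2 + 1).
    have [->|n0] := eqVneq (i./2 + j./2)%N 0%N; first by rewrite spread0 spread1 add0r.
    by rewrite -{1}spread1 IH//; lia.
  have h3 : lam * (spread i./2 + spread j./2 + 1) <= lam * spread (i./2 + j./2 + 1).
    by rewrite ler_pM2l; lra.
  lra.
all: have h3 : lam * (spread i./2 + spread j./2) <= lam * spread (i./2 + j./2);
  by [rewrite ler_pM2l//; lra|lra].
Qed.

Lemma spread_le_sub i j : (i <= j)%N -> spread (j - i) <= spread j - spread i.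
Proof. by move=> ij; rewrite lerBrDr; have := spread_superadd (j - i) i; rewrite subnK. Qed.

Lemma spread_ge1 n : (0 < n)%N -> 1 <= spread n.
Proof.
case: n => // n _; rewrite -addn1; apply: le_trans (spread_superadd _ _).
by rewrite spread1 lerDr spread_ge0.
Qed.

Lemma spread_dist_ge1 i j : i != j -> 1 <= `|spread i - spread j|.
Proof.
wlog ij : i j / (i < j)%N => [hw nij|_].
  have [/hw|/hw|ij] := ltngtP i j; [exact|by rewrite distrC eq_sym; exact|].
  by rewrite ij eqxx in nij.
rewrite distrC; apply: le_trans (ler_norm _).
by apply: le_trans (spread_le_sub _ _ (ltnW ij)); rewrite spread_ge1// subn_gt0.
Qed.

(** The integers sharing all but their last [b] digits form a cylinder of the Cantor set. Its
    diameter is at most [1 + lam + ... + lam ^+ (b - 1)], which is at most [lam ^+ b - 1] since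
    [lam >= 2]. *)
Lemma spread_prefix b n :
  0 <= spread n - lam ^+ b * spread (n %/ 2 ^ b) <= lam ^+ b - 1.
Proof.
have l2 := lam2.
elim: b n => [|b IH] n; first by rewrite divn1 mul1r !subrr lexx.
have /andP[h1 h2] := IH n./2.
have -> : (n %/ 2 ^ b.+1 = n./2 %/ 2 ^ b)%N by rewrite expnS divnMA divn2.
rewrite (spreadE n) exprS -mulrA.
set z := lam ^+ b * _ in h1 h2 *.
have hz1 : 0 <= lam * (spread n./2 - z) by rewrite mulr_ge0//; lra.
have hz2 : lam * (spread n./2 - z) <= lam * (lam ^+ b - 1).
  by rewrite ler_pM2l//; lra.
have o0 : 0 <= (odd n)%:R :> R by [].
have o1 : (odd n)%:R <= 1 :> R by case: odd.
by apply/andP; split; lra.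
Qed.

Lemma spread_lt_pow m n : (n < 2 ^ m)%N -> spread n <= lam ^+ m.
Proof.
have l2 := lam2.
move=> nm; have /andP[_] := spread_prefix m n.
by rewrite divn_small// spread0 mulr0; lra.
Qed.

End Spread.

Section SpreadDim.
Context {R : realType}.
Variable s : R.
Hypothesis s01 : 0 < s <= 1.
Let lam : R := 2 `^ s^-1.

Let s0 : 0 < s. Proof. by case/andP: s01. Qed.

Lemma spread_base_ge2 : 2 <= lam.
Proof.
rewrite -[leLHS]powRr1//; apply: ler_powR; first lra.
by rewrite invf_ge1//; case/andP: s01.
Qed.

Let lam0 : 0 < lam. Proof. by have := spread_base_ge2; lra. Qed.

Lemma spread_base_powR : lam `^ s = 2.
Proof. by rewrite -powRrM mulVf ?powRr1// gt_eqF. Qed.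

(** Halving [n] divides [n + 1] by at most 2 and [spread lam n] by at least [lam], and [lam] to the
    power [s] is 2. *)
Lemma spread_powR_ge n : (0 < n)%N -> n.+1%:R <= 2 * spread lam n `^ s.
Proof.
have l2 := spread_base_ge2.
elim/ltn_ind: n => n IH n0.
have [n1|n1] := leqP n 1.
  have -> : n = 1%N by lia.
  by rewrite spread1 powR1 mulr1.
have h := IH n./2 ltac:(lia) ltac:(lia).
apply: le_trans (_ : 2 * (2 * spread lam n./2 `^ s) <= _).
  apply: le_trans (_ : 2 * n./2.+1%:R <= _); last by rewrite ler_pM2l.
  by rewrite -natrM ler_nat; lia.
rewrite ler_pM2l// -spread_base_powR -powRM ?spread_ge0//; last exact: ltW.
rewrite ge0_ler_powR// ?nnegrE ?mulr_ge0 ?spread_ge0//; try exact: ltW.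
by rewrite [leRHS]spreadE lerDl.
Qed.

Lemma exists_scale (r : R) : exists b, (b = 0%N \/ lam ^+ b <= r) /\ r < lam ^+ b.+1.
Proof.
have l2 := spread_base_ge2.
have [N rN] : exists N, r < lam ^+ N.
  exists (Num.bound r); apply: lt_le_trans (_ : 2 ^+ Num.bound r <= _).
    exact: upper_nthrootP.
  by rewrite ler_pXn2r// nnegrE; lra.
elim: N rN => [|N IH] rN.
  exists 0%N; split; first by left.
  by apply: lt_trans rN _; rewrite expr0 expr1; lra.
have [/IH//|h] := ltP r (lam ^+ N).
by exists N; split=> //; right.
Qed.

(** With [lam ^+ b] comparable to [r], an [r]-separated set has distinct prefixes. These lie in an
    interval of integers, whose length [spread_powR_ge] bounds in terms of its spread, at most
    [2 * (D / lam ^+ b)]. *)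
Lemma packing_bound_spread :
  packing_bound (fun i j => `|spread lam i - spread lam j|) setT 8 s.
Proof.
have l2 := spread_base_ge2.
move=> r D S r0 rD [uS dS] _.
have X1 : 1 <= (D / r) `^ s by rewrite powR_ge1 ?ratio_ge1// ltW.
have [b [hb rb]] := exists_scale r.
have lb1 : 1 <= lam ^+ b by rewrite exprn_ege1//; lra.
have lb0 : 0 < lam ^+ b by lra.
pose u n := (n %/ 2 ^ b)%N.
have hbr : lam ^+ b - 1 <= r by case: hb => [->|]; rewrite ?expr0; lra.
have hbD : lam ^+ b - 1 <= D by lra.
have uI : {in S &, injective u}.
  move=> i j iS jS uij; apply/eqP/negP => /negP nij.
  have /andP[h _] := dS i j iS jS nij.
  have /andP[h1 h2] := spread_prefix lam l2 b i.
  have /andP[h3 h4] := spread_prefix lam l2 b j.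
  rewrite -/(u i) uij in h1 h2; rewrite -/(u j) in h3 h4.
  suff : `|spread lam i - spread lam j| <= lam ^+ b - 1 by lra.
  by rewrite ler_norml; apply/andP; split; lra.
have [S0|SN] := eqVneq S [::]; first by rewrite S0 mulr_ge0 ?powR_ge0.
have [|um [uM [/mapP[i iS iE] /mapP[j jS jE] hm]]] := nat_seq_min_max (map u S).
  by case: (S) SN.
have mM : (um <= uM)%N by have /andP[+ _] := hm _ (map_f u jS); rewrite -jE.
have le_size : (size S <= (uM - um).+1)%N.
  rewrite -(size_map u) -(size_iota um (uM - um).+1).
  apply: uniq_leq_size; first by rewrite map_inj_in_uniq.
  by move=> x /hm; rewrite mem_iota addnS subnKC// ltnS.
apply: le_trans (_ : (uM - um).+1%:R <= _); first by rewrite ler_nat.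
have [->|n0] := posnP (uM - um)%N; first by lra.
apply: le_trans (spread_powR_ge _ n0) _.
have hX : spread lam (uM - um) <= 2 * (D / lam ^+ b).
  apply: le_trans (spread_le_sub lam l2 _ _ mM) _.
  rewrite mulrA ler_pdivlMr//.
  have ij : j != i by apply: contraTneq n0 => ji; rewrite jE iE ji subnn.
  have /andP[_ h] := dS j i jS iS ij.
  have h5 := ler_norm (spread lam j - spread lam i).
  have /andP[h1 h2] := spread_prefix lam l2 b i.
  have /andP[h3 h4] := spread_prefix lam l2 b j.
  rewrite -/(u i) -iE in h1 h2; rewrite -/(u j) -jE in h3 h4.
  lra.
(* One factor 2 comes from [spread_powR_ge], one bounds [2]^ s[, and one is]lam [^ s], the price of
   replacing [lam ^+ b] by [r]. *)
have -> : 8 * (D / r) `^ s = 2 * (2 * (2 * (D / r) `^ s)) by ring.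
rewrite ler_pM2l//.
have s1 : 2 `^ s <= 2 :> R.
  by rewrite -[leRHS]powRr1//; apply: ler_powR; [lra|case/andP: s01].
have D0 : 0 < D by lra.
apply: le_trans (_ : 2 `^ s * (lam `^ s * (D / r) `^ s) <= _); last first.
  by rewrite spread_base_powR ler_wpM2r// mulr_ge0// powR_ge0.
have rV0 : 0 <= r^-1 by rewrite invr_ge0 ltW.
have l0 := ltW lam0; have DR0 := ltW D0; have sR0 := ltW s0.
rewrite -!powRM ?mulr_ge0//.
rewrite ge0_ler_powR ?nnegrE ?mulr_ge0 ?spread_ge0//.
apply: le_trans hX _; rewrite ler_pM2l// mulrCA ler_pM2l//.
by rewrite ler_pdivlMr// mulrC ler_pdivrMr// -exprS ltW.
Qed.

End SpreadDim.

(** * Packing bounds and Assouad dimension in the plane *)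

Lemma seq_preimage {T T' : eqType} (g : T -> T') (A : set T) (S' : seq T') :
  (forall y, y \in S' -> (g @` A) y) ->
  exists S, S' = map g S /\ forall x, x \in S -> A x.
Proof.
elim: S' => [_|y S' IH h]; first by exists [::].
have [z zS|S [-> AS]] := IH; first by apply: h; rewrite in_cons zS orbT.
have [x Ax <-] := h y (mem_head _ _).
exists (x :: S); split=> // z; rewrite in_cons => /orP[/eqP->//|]; exact: AS.
Qed.

(** A set spaced between [r] and [D] pulls back to one spaced between [r / a] and [b * D];
    [1 <= a * b] keeps these two scales in order. *)
Lemma packing_bound_image {R : realType} {T T' : eqType} (d : T -> T -> R)
    (d' : T' -> T' -> R) (g : T -> T') (A : set T) (a b C s : R) :
  0 < a -> 0 < b -> 1 <= a * b ->
  (forall x y, A x -> A y -> x != y ->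
     d' (g x) (g y) <= a * d x y /\ d x y <= b * d' (g x) (g y)) ->
  packing_bound d A C s -> packing_bound d' (g @` A) (C * (a * b) `^ s) s.
Proof.
move=> a0 b0 ab hg hA r D S' r0 rD [uS' dS'] /seq_preimage[S [ES AS]].
subst S'; rewrite size_map.
have [uS gI] : uniq S /\ {in S &, injective g}.
  split; first exact: map_uniq uS'.
  move=> x y xS yS gxy; apply/eqP; apply: contraT => xy.
  have := uS'; rewrite (perm_uniq (perm_map g (perm_to_rem xS))) /= => /andP[+ _].
  have yS1 : y \in rem x S.
    by rewrite (mem_rem_uniq _ (map_uniq uS')) inE eq_sym xy.
  by rewrite gxy map_f.
have D0 : 0 < D by lra.
have ab0 : 0 <= a * b by rewrite mulr_ge0// ltW.
have Dr0 : 0 <= D / r by rewrite divr_ge0// ltW.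
rewrite -mulrA -powRM//.
have -> : a * b * (D / r) = (b * D) / (r / a).
  by rewrite invfM invrK; ring.
apply: hA => //.
- by rewrite divr_gt0.
- rewrite ler_pdivrMr//; apply: le_trans rD _.
  by rewrite mulrAC (mulrC b) ler_peMl//; lra.
- split=> // x y xS yS xy.
  have [h1 h2] := hg x y (AS _ xS) (AS _ yS) xy.
  have gxy : g x != g y by apply: contra xy => /eqP/gI-> //.
  have /andP[h3 h4] := dS' _ _ (map_f g xS) (map_f g yS) gxy.
  apply/andP; split; first by rewrite ltr_pdivrMr//; lra.
  by apply: le_trans h2 _; rewrite ler_pM2l.
Qed.

Section Plane.
Context {R : realType}.
Notation P2 := (R * R)%type.
Notation edist := Defs.edist.
Implicit Types (a b c t r D s C : R) (x y z : P2).

Definition hyp a b : R := Num.sqrt (a ^+ 2 + b ^+ 2).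

Lemma hyp_sq a b : hyp a b ^+ 2 = a ^+ 2 + b ^+ 2.
Proof. by rewrite sqr_sqrtr// addr_ge0// sqr_ge0. Qed.

Lemma hyp_ge0 a b : 0 <= hyp a b. Proof. exact: sqrtr_ge0. Qed.

Lemma le_of_sq a b : 0 <= b -> a ^+ 2 <= b ^+ 2 -> `|a| <= b.
Proof.
move=> b0 ab; rewrite -(ger0_norm b0) -ler_sqr ?nnegrE ?normr_ge0//.
by rewrite !real_normK ?num_real.
Qed.

Lemma hyp_le a b c : 0 <= c -> a ^+ 2 + b ^+ 2 <= c ^+ 2 -> hyp a b <= c.
Proof.
by move=> c0 h; rewrite -(ger0_norm (hyp_ge0 a b)) le_of_sq// hyp_sq.
Qed.

Lemma ler_normhypl a b : `|a| <= hyp a b.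
Proof. by apply: le_of_sq; rewrite ?hyp_ge0// hyp_sq lerDl sqr_ge0. Qed.

Lemma ler_normhypr a b : `|b| <= hyp a b.
Proof. by apply: le_of_sq; rewrite ?hyp_ge0// hyp_sq lerDr sqr_ge0. Qed.

Lemma hyp_le_norm a b : hyp a b <= `|a| + `|b|.
Proof.
apply: hyp_le; first by rewrite addr_ge0.
rewrite sqrrD !real_normK ?num_real//.
have := mulr_ge0 (normr_ge0 a) (normr_ge0 b); lra.
Qed.

Lemma dot_le_hyp a b c t : `|a * c + b * t| <= hyp a b * hyp c t.
Proof.
apply: le_of_sq; first by rewrite mulr_ge0// hyp_ge0.
rewrite exprMn !hyp_sq.
have := sqr_ge0 (a * t - b * c); lra.
Qed.

Lemma hyp_triangle a b c t : hyp (a + c) (b + t) <= hyp a b + hyp c t.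
Proof.
apply: hyp_le; first by rewrite addr_ge0 ?hyp_ge0.
rewrite (sqrrD (hyp a b)) !hyp_sq.
have := le_trans (ler_norm _) (dot_le_hyp a b c t); lra.
Qed.

Lemma edistE x y : edist x y = hyp (x.1 - y.1) (x.2 - y.2). Proof. by []. Qed.

Lemma pseudometric_edist : pseudometric (@edist R).
Proof.
split=> [x y|x y z]; rewrite !edistE.
  by rewrite /hyp -(sqrrN (x.1 - y.1)) -(sqrrN (x.2 - y.2)) !opprB.
by apply: le_trans (hyp_triangle _ _ _ _); rewrite !addrA !subrK.
Qed.

Lemma edistxx x : edist x x = 0.
Proof. by rewrite edistE /hyp !subrr expr0n addr0 sqrtr0. Qed.

(** The distance between projections, pulled back to the plane, so that a set and all its
    projections can be studied on the same points. *)
Definition pdist t x y : R := `|(x.1 - y.1) * cos t + (x.2 - y.2) * sin t|.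

Lemma pseudometric_pdist t : pseudometric (pdist t).
Proof.
split=> [x y|x y z]; rewrite /pdist.
  by rewrite -normrN; congr `|_|; ring.
by apply: le_trans (ler_normD _ _); rewrite le_eqVlt; apply/orP; left;
  apply/eqP; congr `|_|; ring.
Qed.

Lemma hyp_cos_sin t : hyp (cos t) (sin t) = 1.
Proof. by rewrite /hyp cos2Dsin2 sqrtr1. Qed.

Lemma pdist_le_edist t x y : pdist t x y <= edist x y.
Proof. by apply: le_trans (dot_le_hyp _ _ _ _) _; rewrite hyp_cos_sin mulr1. Qed.

Definition proj_pt t x : P2 :=
  ((x.1 * cos t + x.2 * sin t) * cos t, (x.1 * cos t + x.2 * sin t) * sin t).

Lemma edist_proj t x y : edist (proj_pt t x) (proj_pt t y) = pdist t x y.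
Proof.
rewrite edistE /proj_pt /= /hyp -!mulrBl !exprMn -mulrDr cos2Dsin2 mulr1.
by rewrite sqrtr_sqr /pdist; congr `|_|; ring.
Qed.

Lemma packing_bound_proj t (F : set P2) C s :
  packing_bound (pdist t) F C s -> packing_bound (@edist R) (proj_line t F) C s.
Proof.
move=> /(packing_bound_image _ (@edist R) (proj_pt t) F 1 1)-/(_ ltr01 ltr01).
rewrite mulr1 powR1 mulr1; apply=> // x y _ _ _.
by rewrite edist_proj !mul1r.
Qed.

(** The centres form an [r / 8]-separated subset of the ball of largest size, which exists because
    the packing bound limits the sizes; 16 is the ratio of [2 * D] to [r / 8], up to the factor
    [D / r]. *)
Lemma coverable_packing (E : set P2) C s r D x : 0 <= s -> 0 <= C ->
  packing_bound (@edist R) E C s -> 0 < r -> r < D ->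
  exists n, coverable (cball2 x D `&` E) r n /\
    n%:R <= C * 16 `^ s * (D / r) `^ s.
Proof.
move=> s0 C0 hE r0 rD.
pose G (S : seq P2) := (forall y, y \in S -> (cball2 x D `&` E) y) /\
  spaced (@edist R) (r / 8) (2 * D) S.
pose p n := `[< exists S, size S = n /\ G S >].
have GE S : G S -> (size S)%:R <= C * 16 `^ s * (D / r) `^ s.
  move=> [SE sS]; rewrite -mulrA -powRM; [|lra|by rewrite divr_ge0; lra].
  have -> : 16 * (D / r) = (2 * D) / (r / 8).
    by rewrite invfM invrK; ring.
  by apply: (hE _ _ S) => // [||y /SE[]//]; lra.
have ex : exists n, p n.
  by exists 0%N; apply/asboolP; exists [::].
have ub n : p n -> (n <= Num.bound (C * 16 `^ s * (D / r) `^ s))%N.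
  move=> /asboolP[S [<- /GE h]]; rewrite -(ler_nat R); apply: le_trans h _.
  by apply/ltW/archi_boundP; rewrite !mulr_ge0// powR_ge0.
have [n /asboolP[S [Sn GS]] nmax] := ex_maxnP ex ub.
exists n; split; last by rewrite -Sn; exact: GE.
have [SE [uS dS]] := GS.
(* In the product, [ball] is an open square of half-side [r / 4]; its Euclidean diameter is below
   [r]. *)
exists (fun i => ball (nth x S i) (r / 4)); split.
  move=> i _; split; first exact: ball_open.
  move=> y z [/= y1 y2] [z1 z2].
  set w := nth x S i in y1 y2 z1 z2.
  rewrite /ball /= in y1 y2 z1 z2.
  rewrite edistE; apply: hyp_le; first by lra.
  have d1 : (y.1 - z.1) ^+ 2 <= (r / 2) ^+ 2.
    rewrite -(real_normK (num_real (y.1 - z.1))) ler_sqr ?nnegrE//; last lra.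
    have := ler_normD (w.1 - z.1) (y.1 - w.1); rewrite (distrC y.1 w.1).
    by rewrite addrC addrA subrK => h; lra.
  have d2 : (y.2 - z.2) ^+ 2 <= (r / 2) ^+ 2.
    rewrite -(real_normK (num_real (y.2 - z.2))) ler_sqr ?nnegrE//; last lra.
    have := ler_normD (w.2 - z.2) (y.2 - w.2); rewrite (distrC y.2 w.2).
    by rewrite addrC addrA subrK => h; lra.
  have := sqr_ge0 r; lra.
move=> y [yD yE].
have [z zS hz] : exists2 z, z \in S & edist z y <= r / 8.
  apply: contrapT => nz.
  have far z : z \in S -> r / 8 < edist z y.
    by move=> zS; rewrite ltNge; apply/negP => ?; apply: nz; exists z.
  have yS : y \notin S by apply/negP => /far; rewrite edistxx; lra.
  suff : p n.+1 by move=> /nmax; rewrite ltnn.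
  have [eC eT] := pseudometric_edist.
  apply/asboolP; exists (y :: S); split; first by rewrite /= Sn.
  split=> [z|]; first by rewrite in_cons => /orP[/eqP->//|/SE].
  split=> [|z w]; first by rewrite /= yS.
  have near z' : z' \in S -> edist z' y <= 2 * D.
    move=> /SE[h _]; have := eT z' x y; rewrite (eC z' x).
    by rewrite /cball2 /= in h yD; lra.
  rewrite !in_cons => /orP[/eqP->|zS] /orP[/eqP->|wS].
  - by rewrite eqxx.
  - by move=> _; rewrite eC far// near.
  - by move=> _; rewrite far// near.
  - exact: dS.
exists (index z S); first by rewrite /= -Sn index_mem.
rewrite nth_index//.
have h1 := ler_normhypl (z.1 - y.1) (z.2 - y.2).
have h2 := ler_normhypr (z.1 - y.1) (z.2 - y.2).
rewrite -edistE in h1 h2.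
by split; rewrite /ball /=; lra.
Qed.

Lemma Ncover_le (E : set P2) r n : coverable E r n -> Ncover E r <= n%:R.
Proof.
move=> h; apply: ge_inf; last by exists n.
by exists 0 => _ [m _ <-].
Qed.

(** Pigeonhole: an open set of diameter at most [r] contains at most one point of [S]. A cover must
    exist, since the infimum of the empty set is 0 by convention. *)
Lemma Ncover_ge (E : set P2) r n (S : seq P2) : coverable E r n ->
  uniq S -> (forall x, x \in S -> E x) ->
  {in S &, forall x y, x != y -> r < edist x y} -> (size S)%:R <= Ncover E r.
Proof.
move=> En uS SE dS; apply: lb_le_inf; first by exists n%:R, n.
move=> _ [m [U [hU EU]] <-]; rewrite ler_nat.
have /choice[f fP] : forall x, exists i, x \in S -> (i < m)%N /\ U i x.
  move=> x; have [xS|_] := boolP (x \in S); last by exists 0%N.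
  by have [i im Ui] := EU _ (SE _ xS); exists i.
rewrite -(size_map f) -(size_iota 0 m); apply: uniq_leq_size.
  rewrite map_inj_in_uniq// => x y xS yS fxy; apply/eqP; apply: contraT => xy.
  have [im Ux] := fP _ xS; have [_ Uy] := fP _ yS; rewrite -fxy in Uy.
  have [_ /(_ _ _ Ux Uy)] := hU _ im.
  by have := dS x y xS yS xy; lra.
by move=> _ /mapP[x /fP[h _] ->]; rewrite mem_iota.
Qed.

Lemma assouad_dim_ge0 (F : set P2) : (0 <= assouad_dim F)%E.
Proof. by apply: le_ereal_inf_tmp => _ [s [s0 _] <-]; rewrite lee_fin. Qed.

Lemma assouad_dim_le (F : set P2) C s : 0 <= s -> 0 <= C ->
  packing_bound (@edist R) F C s -> (assouad_dim F <= s%:E)%E.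
Proof.
move=> s0 C0 hF; apply: ereal_inf_lbound; exists s => //; split=> //.
exists (C * 16 `^ s + 1); split.
  by rewrite ltr_wpDl// mulr_ge0// powR_ge0.
move=> D r D0 r0 rD x Fx.
have [n [/Ncover_le h hn]] := coverable_packing F C s r D x s0 C0 hF r0 rD.
apply: le_trans h _; apply: le_trans hn _.
by rewrite ler_wpM2r ?powR_ge0// lerDl.
Qed.

(** The packing bound, whatever its exponent [s], only guarantees finite covers, so that separated
    sets bound [Ncover] from below. *)
Lemma assouad_dim_ge (F : set P2) C s v : 0 <= s -> 0 <= C ->
  packing_bound (@edist R) F C s ->
  (forall t C', 0 <= t -> t < v -> 0 < C' -> exists (r D : R) x (S : seq P2),
    [/\ 0 < r, r < D, F x & uniq S] /\
    [/\ forall y, y \in S -> F y /\ edist x y <= D,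
        {in S &, forall y z, y != z -> r < edist y z} &
        C' * (D / r) `^ t < (size S)%:R]) ->
  (v%:E <= assouad_dim F)%E.
Proof.
move=> s0 C0 hF h; apply: le_ereal_inf_tmp => _ [t [t0 [C' [C'0 hC]]] <-].
rewrite lee_fin leNgt; apply/negP => tv.
have [r [D [x [S [[r0 rD Fx uS] [SF dS hS]]]]]] := h t C' t0 tv C'0.
have [n [hn _]] := coverable_packing F C s r D x s0 C0 hF r0 rD.
have D0 : 0 < D by lra.
have h1 := hC D r D0 r0 rD x Fx.
have h2 : (size S)%:R <= Ncover (cball2 x D `&` F) r.
  by apply: (Ncover_ge _ _ n) => // y /SF[].
by move: (lt_le_trans hS (le_trans h2 h1)); rewrite ltxx.
Qed.

End Plane.

(** * Clusters that are Cantor-like in a single direction *)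

Section ClusterScales.
Context {R : realType}.

(* A cluster with 2 ^ n points has its Cantor coordinates in
   L * cl_gap n * [0, cl_diam n], at mutual distances at least L * cl_gap n,
   while its heights L * cl_ratio n ^- j stay above 16 n times the width of the
   Cantor coordinates.  The ratio exceeds cl_diam n so much that, once projected,
   at most one height lies between the finest gap and the width. *)
Definition cl_diam (n : nat) : R := 2 ^+ (n * n).
Definition cl_ratio (n : nat) : R := 1024 * cl_diam n.
Definition cl_gap (n : nat) : R :=
  (16 * n%:R * cl_diam n)^-1 * cl_ratio n ^- (2 ^ n).

Lemma cl_diam_ge1 n : 1 <= cl_diam n.
Proof. by rewrite exprn_ege1// ler1n. Qed.

Lemma cl_ratio_ge n : 1024 <= cl_ratio n.
Proof. by have := cl_diam_ge1 n; rewrite /cl_ratio; lra. Qed.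

Lemma cl_gap_gt0 n : (0 < n)%N -> 0 < cl_gap n.
Proof.
move=> n0; have h1 := cl_diam_ge1 n; have h2 := cl_ratio_ge n.
rewrite /cl_gap mulr_gt0 ?invr_gt0 ?exprn_gt0 ?mulr_gt0 ?ltr0n//; lra.
Qed.

Lemma cl_gap_le n j : (0 < n)%N -> (j < 2 ^ n)%N ->
  16 * n%:R * (cl_gap n * cl_diam n) <= cl_ratio n ^- j.
Proof.
move=> n0 jn; have h1 := cl_diam_ge1 n; have h2 := cl_ratio_ge n.
have n1 : 0 < n%:R :> R by rewrite ltr0n.
have -> : 16 * n%:R * (cl_gap n * cl_diam n) = cl_ratio n ^- (2 ^ n).
  by rewrite /cl_gap; field; rewrite !gt_eqF ?exprn_gt0//; lra.
rewrite lef_pV2 ?posrE ?exprn_gt0//; try lra.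
by apply: ler_weXn2l; [lra|exact: ltnW].
Qed.

Lemma cl_gap_le1 n : (0 < n)%N -> cl_gap n <= 1.
Proof.
move=> n0; have h1 := cl_diam_ge1 n.
have h2 := cl_gap_le n 0 n0 ltac:(by rewrite expn_gt0).
rewrite expr0 invr1 in h2.
have n1 : 1 <= n%:R :> R by rewrite ler1n.
have g0 := cl_gap_gt0 n n0.
have h3 : cl_gap n <= cl_gap n * cl_diam n by rewrite ler_peMr// ltW.
have h4 : cl_gap n * cl_diam n <= 16 * n%:R * (cl_gap n * cl_diam n).
  by rewrite ler_peMl; lra.
lra.
Qed.

End ClusterScales.

Section Cluster.
Context {R : realType}.
Notation edist := Defs.edist.
Variables (al : R) (p : R * R) (L : R) (n : nat) (s : R).

Definition cl_height (j : nat) : R := L * cl_ratio n ^- j.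
Definition cl_shift (j : nat) : R := L * cl_gap n * spread (2 `^ s^-1) j.
Definition cl_pt (j : nat) : R * R :=
  (p.1 + cl_shift j * cos al - cl_height j * sin al,
   p.2 + cl_shift j * sin al + cl_height j * cos al).
(* The point [cl_pt j] has coordinates [cl_shift j], [cl_height j] along the unit
   vector of angle [al] and its normal, relative to [p]. *)
Definition cl_set : set (R * R) := cl_pt @` [set j | (j < 2 ^ n)%N].

Hypotheses (L0' : 0 < L) (n0 : (0 < n)%N) (sn : n%:R^-1 <= s <= 1).

Let lam : R := 2 `^ s^-1.

Let s01 : 0 < s <= 1.
Proof.
have /andP[h ->] := sn; rewrite andbT; apply: lt_le_trans h.
by rewrite invr_gt0 ltr0n.
Qed.

Let lam2 : 2 <= lam. Proof. exact: spread_base_ge2. Qed.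

Lemma cl_step_gt0 : 0 < L * cl_gap n.
Proof. by rewrite mulr_gt0 ?cl_gap_gt0. Qed.

Lemma cl_extent_gt0 : 0 < L * cl_gap n * cl_diam n.
Proof. by rewrite mulr_gt0 ?cl_step_gt0 ?exprn_gt0. Qed.

(** This is where [s >= 1 / n] is used: it gives [lam <= 2 ^+ n], so one width [cl_diam n] fits all
    admissible [s]. *)
Lemma cl_base_pow_le : lam ^+ n <= cl_diam n.
Proof.
have l2 := lam2; have /andP[s0 s1] := s01; have /andP[sn1 _] := sn.
have l0 : 0 <= lam by lra.
rewrite /cl_diam exprM ler_pXn2r ?nnegrE ?exprn_ge0//.
rewrite -powR_mulrn//; apply: ler_powR; first lra.
by rewrite -[leRHS]invrK lef_pV2 ?posrE// invr_gt0 ltr0n.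
Qed.

Lemma cl_shift_ge0 j : 0 <= cl_shift j.
Proof.
rewrite /cl_shift mulr_ge0 ?spread_ge0//.
by rewrite mulr_ge0// ltW// cl_gap_gt0.
Qed.

Lemma cl_shift_le_pow j : (j < 2 ^ n)%N -> cl_shift j <= L * cl_gap n * lam ^+ n.
Proof.
move=> jn; have t0 := cl_step_gt0.
by rewrite /cl_shift ler_pM2l//; exact: spread_lt_pow.
Qed.

Lemma cl_shift_le j : (j < 2 ^ n)%N -> cl_shift j <= L * cl_gap n * cl_diam n.
Proof.
move=> /cl_shift_le_pow h; apply: le_trans h _.
have t0 := cl_step_gt0.
by rewrite ler_pM2l//; exact: cl_base_pow_le.
Qed.

Lemma cl_height_ge0 j : 0 <= cl_height j.
Proof.
have h := @cl_ratio_ge R n.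
by rewrite /cl_height mulr_ge0 ?invr_ge0 ?exprn_ge0 ?(ltW L0')//; lra.
Qed.

Lemma cl_heightS j : cl_ratio n * cl_height j.+1 = cl_height j.
Proof.
have h := @cl_ratio_ge R n.
have r0 : cl_ratio n != 0 :> R by rewrite gt_eqF//; lra.
by rewrite /cl_height exprS invfM mulrCA mulVKf.
Qed.

Lemma cl_height_ratio i j : (i < j)%N -> cl_ratio n * cl_height j <= cl_height i.
Proof.
have h := @cl_ratio_ge R n.
elim: j => // j IH; rewrite ltnS leq_eqVlt => /orP[/eqP->|/IH ij].
  by rewrite cl_heightS.
rewrite cl_heightS; apply: le_trans ij; rewrite ler_peMl ?cl_height_ge0//; lra.
Qed.

Lemma cl_height_le j : cl_height j <= L.
Proof.
have h := @cl_ratio_ge R n.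
rewrite /cl_height ler_piMr ?(ltW L0')// invf_le1 ?exprn_gt0 ?exprn_ege1//; lra.
Qed.

Lemma cl_gap_le_height j : (j < 2 ^ n)%N ->
  16 * n%:R * (L * cl_gap n * cl_diam n) <= cl_height j.
Proof.
move=> jn.
have -> : 16 * n%:R * (L * cl_gap n * cl_diam n) =
  L * (16 * n%:R * (cl_gap n * cl_diam n)) by ring.
by rewrite /cl_height ler_pM2l// cl_gap_le.
Qed.

Lemma cl_shift_le_height j : (j < 2 ^ n)%N -> 16 * cl_shift j <= cl_height j.
Proof.
move=> jn; have h := cl_gap_le_height j jn; have h1 := cl_shift_le j jn.
apply: le_trans h; have n1 : 1 <= n%:R :> R by rewrite ler1n.
rewrite -mulrA ler_pM2l//; apply: le_trans h1 _; rewrite ler_peMl//.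
exact/ltW/cl_extent_gt0.
Qed.

Lemma pdist_cl_pt th i j : pdist th (cl_pt i) (cl_pt j) =
  `|(cl_shift i - cl_shift j) * cos (th - al) +
    (cl_height i - cl_height j) * sin (th - al)|.
Proof. by rewrite /pdist /= cosB sinB; congr `|_|; ring. Qed.

Lemma pdist_cl_base th j : pdist th p (cl_pt j) =
  `|cl_shift j * cos (th - al) + cl_height j * sin (th - al)|.
Proof. by rewrite /pdist -normrN /= cosB sinB; congr `|_|; ring. Qed.

Lemma edist_cl_base j : edist p (cl_pt j) = hyp (cl_shift j) (cl_height j).
Proof.
rewrite edistE /= /hyp; congr (Num.sqrt _).
transitivity ((cl_shift j ^+ 2 + cl_height j ^+ 2) * (cos al ^+ 2 + sin al ^+ 2));
  last by rewrite cos2Dsin2 mulr1.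
by ring.
Qed.

Lemma edist_cluster_le y : cl_set y -> edist p y <= 2 * L.
Proof.
move=> [j jn <-]; rewrite edist_cl_base; apply: le_trans (hyp_le_norm _ _) _.
rewrite !ger0_norm ?cl_shift_ge0 ?cl_height_ge0//.
have := cl_shift_le_height j jn; have := cl_height_le j; have := cl_shift_ge0 j.
by lra.
Qed.

Lemma norm_cos_ge th : `|sin (th - al)| <= 1 / 2 -> 1 / 2 <= `|cos (th - al)|.
Proof.
move=> h; rewrite leNgt; apply/negP => h'.
have h1 : `|sin (th - al)| ^+ 2 <= (1 / 2) ^+ 2 by rewrite ler_sqr ?nnegrE//; lra.
have h2 : `|cos (th - al)| ^+ 2 < (1 / 2) ^+ 2 by rewrite ltr_sqr ?nnegrE//; lra.
have := cos2Dsin2 (th - al).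
by rewrite !real_normK ?num_real// in h1 h2 *; lra.
Qed.

(** The heights contribute at most an eighth of [L * cl_gap n], whereas distinct values of [spread]
    differ by at least 1 and the cosine is at least 1/2 in absolute value: the Cantor term
    dominates. *)
Lemma cl_pt_bilipschitz th i j : `|sin (th - al)| <= 1 / 2 -> i != j ->
  8 * (cl_height i * `|sin (th - al)|) <= L * cl_gap n ->
  8 * (cl_height j * `|sin (th - al)|) <= L * cl_gap n ->
  L * cl_gap n / 4 * `|spread lam i - spread lam j| <=
    pdist th (cl_pt i) (cl_pt j) <=
  2 * (L * cl_gap n) * `|spread lam i - spread lam j|.
Proof.
move=> /[dup] sle /norm_cos_ge cge ij hi hj; rewrite pdist_cl_pt /cl_shift -mulrBr.
rewrite -/lam.
have X1 := spread_dist_ge1 lam lam2 i j ij.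
set X := spread lam i - _ in X1 *.
have t0 := cl_step_gt0.
set tau := L * cl_gap n in t0 hi hj *; clearbody tau.
set S := (cl_height i - _) * _.
have hS : 8 * `|S| <= tau.
  rewrite normrM.
  have i0 := cl_height_ge0 i; have j0 := cl_height_ge0 j.
  have sn0 := normr_ge0 (sin (th - al)).
  have [hij|hij] := leP (cl_height j) (cl_height i).
    apply: le_trans hi; rewrite ler_pM2l// ler_wpM2r// ger0_norm; lra.
  apply: le_trans hj; rewrite ler_pM2l// ler_wpM2r// ltr0_norm; lra.
have c1 : `|cos (th - al)| <= 1 by exact: cos_max.
have hT : `|tau * X * cos (th - al)| = tau * (`|X| * `|cos (th - al)|).
  by rewrite !normrM (gtr0_norm t0) mulrA.
have h1 : tau * (`|X| * `|cos (th - al)|) <= tau * `|X|.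
  by rewrite ler_pM2l// ler_piMr.
have h2 : tau * (`|X| * (1 / 2)) <= tau * (`|X| * `|cos (th - al)|).
  by rewrite ler_pM2l// ler_wpM2l.
have h3 : tau <= tau * `|X| by rewrite ler_peMr// ltW.
have h4 := ler_normD (tau * X * cos (th - al)) S.
have h5 := lerB_normD (tau * X * cos (th - al)) S.
rewrite hT in h4 h5.
by apply/andP; split; lra.
Qed.

(* In the direction [th], a projected height is negligible (flat), dominant
   (steep), or comparable to the Cantor coordinates (mid). *)
Definition cl_flat th : set nat :=
  [set j | (j < 2 ^ n)%N /\ 8 * (cl_height j * `|sin (th - al)|) <= L * cl_gap n].
Definition cl_mid th : set nat :=
  [set j | (j < 2 ^ n)%N /\ (L * cl_gap n < 8 * (cl_height j * `|sin (th - al)|)) /\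
     cl_height j * `|sin (th - al)| < 16 * (L * cl_gap n * cl_diam n)].
Definition cl_steep th : set nat :=
  [set j | (j < 2 ^ n)%N /\
     16 * (L * cl_gap n * cl_diam n) <= cl_height j * `|sin (th - al)|].

Lemma packing_bound_flat th : `|sin (th - al)| <= 1 / 2 ->
  packing_bound (pdist th) (cl_pt @` cl_flat th) 64 s.
Proof.
move=> sle; have /andP[s0 s1] := s01.
have t0 := cl_step_gt0.
have e8 : 2 * (L * cl_gap n) * (4 / (L * cl_gap n)) = 8 :> R.
  by field; rewrite !gt_eqF// cl_gap_gt0.
apply: (@packing_boundS _ _ _ _ (8 * 8 `^ s) _ s) => //.
- have : 8 `^ s <= 8 :> R.
    by rewrite -[leRHS]powRr1//; apply: ler_powR; [lra|].
  by lra.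
- have := packing_bound_image (fun i j => `|spread lam i - spread lam j|)
  (pdist th) cl_pt (cl_flat th) (2 * (L * cl_gap n)) (4 / (L * cl_gap n)) 8 s.
  rewrite e8; apply.
  + by rewrite mulr_gt0.
  + by rewrite divr_gt0.
  + by lra.
  + move=> i j [_ hi] [_ hj] ij.
    have /andP[h1 h2] := cl_pt_bilipschitz th i j sle ij hi hj.
    split=> //; rewrite mulrAC ler_pdivlMr//; lra.
  + by apply: packing_bound_sub (packing_bound_spread s s01).
Qed.

(** The window defining [cl_mid] spans a ratio [128 * cl_diam n], below the ratio [cl_ratio n] of
    consecutive heights, so it catches at most one of them. *)
Lemma packing_bound_mid th : packing_bound (pdist th) (cl_pt @` cl_mid th) 1 0.
Proof.
have d0 : 0 < cl_diam n :> R by rewrite exprn_gt0.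
have t0 := cl_step_gt0.
have sn0 := normr_ge0 (sin (th - al)).
have uniq_mid i j : cl_mid th i -> cl_mid th j -> i = j.
  wlog ij : i j / (i < j)%N => [hw hi hj|].
    by have [/hw|/hw|//] := ltngtP i j; [exact|move=> /(_ hj hi)].
  move=> [_ [_ hi]] [_ [hj _]].
  have h : cl_ratio n * (cl_height j * `|sin (th - al)|) <=
           cl_height i * `|sin (th - al)|.
    by rewrite mulrA ler_wpM2r// cl_height_ratio.
  have h2 : cl_diam n * (L * cl_gap n) <
      cl_diam n * (8 * (cl_height j * `|sin (th - al)|)) by rewrite ltr_pM2l.
  have h3 : 0 < cl_diam n * (L * cl_gap n) by rewrite mulr_gt0.
  by exfalso; rewrite /cl_ratio in h; lra.
have [[j hj]|hN] := pselect (exists j, cl_mid th j).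
  apply: packing_bound_sub (packing_bound_seq (pdist th) [:: cl_pt j]).
  by move=> _ [i hi <-] /=; rewrite (uniq_mid i j hi hj) mem_head.
apply: (@packing_boundS _ _ _ _ 0 _ 0) => //.
apply: packing_bound_sub (packing_bound_seq (pdist th) [::]).
by move=> _ [i hi <-]; exfalso; apply: hN; exists i.
Qed.

Lemma cluster_split th : cl_set `<=`
  cl_pt @` cl_flat th `|` cl_pt @` cl_mid th `|` cl_pt @` cl_steep th.
Proof.
move=> _ [j jn <-].
have [h1|h1] := leP (8 * (cl_height j * `|sin (th - al)|)) (L * cl_gap n).
  by left; left; exists j.
have [h2|h2] := leP (16 * (L * cl_gap n * cl_diam n)) (cl_height j * `|sin (th - al)|).
  by right; exists j.
by left; right; exists j.
Qed.

Lemma cluster_steep th : 1 <= n%:R * `|sin (th - al)| ->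
  cl_set `<=` cl_pt @` cl_steep th.
Proof.
move=> h _ [j jn <-]; exists j => //; split=> //.
have h0 := cl_gap_le_height j jn; have sn0 := normr_ge0 (sin (th - al)).
apply: le_trans (_ : 16 * n%:R * (L * cl_gap n * cl_diam n) * `|sin (th - al)| <= _);
  last by rewrite ler_wpM2r.
have h3 : 0 < L * cl_gap n * cl_diam n.
  exact: cl_extent_gt0.
have h4 : L * cl_gap n * cl_diam n <=
    L * cl_gap n * cl_diam n * (n%:R * `|sin (th - al)|).
  by rewrite ler_peMr// ltW.
by lra.
Qed.

(** Heights are at most [L], so for such a small angle every point is flat and the whole Cantor set
    is visible. Its [2 ^ n] points have ratio of scales comparable to [lam ^+ n], whose power [s] is
    again [2 ^ n]. *)
Lemma cluster_effective th : 8 * `|sin (th - al)| <= cl_gap n ->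
  exists S : seq (R * R),
  [/\ size S = (2 ^ n)%N, uniq S, forall y, y \in S -> cl_set y,
    {in S &, forall y z, y != z -> L * cl_gap n / 8 < pdist th y z} &
    {in S &, forall y z, pdist th y z <= 2 * (L * cl_gap n) * lam ^+ n}].
Proof.
move=> h; have g1 := @cl_gap_le1 R n n0.
have sle : `|sin (th - al)| <= 1 / 2 by lra.
have t0 := cl_step_gt0.
have flat j : 8 * (cl_height j * `|sin (th - al)|) <= L * cl_gap n.
  rewrite mulrCA; apply: ler_pM => //; last exact: cl_height_le.
  exact: cl_height_ge0.
have far i j : cl_pt i != cl_pt j -> L * cl_gap n / 8 < pdist th (cl_pt i) (cl_pt j).
  move=> ij; have {}ij : i != j by apply: contra ij => /eqP->.
  have /andP[h1 _] := cl_pt_bilipschitz th i j sle ij (flat i) (flat j).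
  have h3 := spread_dist_ge1 lam lam2 i j ij.
  have h4 : L * cl_gap n <= L * cl_gap n * `|spread lam i - spread lam j|.
    by rewrite ler_peMr// ltW.
  by lra.
exists (map cl_pt (iota 0 (2 ^ n))); split.
- by rewrite size_map size_iota.
- rewrite map_inj_uniq ?iota_uniq// => i j ij; apply/eqP; apply: contraT => nij.
  have /andP[h1 _] := cl_pt_bilipschitz th i j sle nij (flat i) (flat j).
  have h3 := spread_dist_ge1 lam lam2 i j nij.
  have h4 : L * cl_gap n <= L * cl_gap n * `|spread lam i - spread lam j|.
    by rewrite ler_peMr// ltW.
  move: h1; rewrite ij /pdist !subrr !mul0r addr0 normr0; lra.
- by move=> _ /mapP[j jn ->]; exists j => //; rewrite mem_iota in jn.
- by move=> _ _ /mapP[i _ ->] /mapP[j _ ->]; exact: far.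
- move=> _ _ /mapP[i + ->] /mapP[j + ->]; rewrite !mem_iota !add0n /= => iN jN.
  have [->|ij] := eqVneq i j.
    have l0 : 0 <= lam by have := lam2; lra.
    by rewrite /pdist !subrr !mul0r addr0 normr0 mulr_ge0 ?exprn_ge0// mulr_ge0// ltW.
  have /andP[_ h2] := cl_pt_bilipschitz th i j sle ij (flat i) (flat j).
  have t2 : 0 < 2 * (L * cl_gap n) by lra.
  apply: le_trans h2 _; rewrite ler_pM2l//.
  have := spread_lt_pow lam lam2 n i iN; have := spread_lt_pow lam lam2 n j jN.
  have := spread_ge0 lam lam2 i; have := spread_ge0 lam lam2 j.
  by rewrite ler_norml => *; apply/andP; split; lra.
Qed.

End Cluster.

(** Cantor coordinates are at most a sixteenth of the heights, so distances to [p] are comparable to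
    the heights and the cluster is lacunary around [p]. *)
Lemma packing_bound_cluster_edist {R : realType} (e : R) : 0 < e ->
  exists2 C : R, 0 <= C & forall al p (L : R) n s,
    0 < L -> (0 < n)%N -> n%:R^-1 <= s <= 1 ->
    packing_bound (@Defs.edist R) (cl_set al p L n s) C e.
Proof.
move=> e0; have [C C0 hC] := @packing_bound_lacunary R (R * R)%type e e0.
exists C => // al p L n s L0 n0 sn.
have cn := @cl_ratio_ge R n.
apply: (hC _ p _ _ (cl_height L n)) => [|k|k|k kn].
- exact: pseudometric_edist.
- exact: cl_height_ge0.
- rewrite -(cl_heightS L n k); apply: ler_wpM2r; [exact: cl_height_ge0|lra].
rewrite edist_cl_base.
have h0 := cl_height_ge0 L n L0 k; have h1 := cl_shift_ge0 L n s L0 n0 sn k.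
have h2 := cl_shift_le_height L n s L0 n0 sn k kn.
have h3 := ler_normhypr (cl_shift L n s k) (cl_height L n k).
have h4 := hyp_le_norm (cl_shift L n s k) (cl_height L n k).
rewrite !ger0_norm// in h3 h4.
by apply/andP; split; lra.
Qed.

Lemma packing_bound_cluster_pdist {R : realType} (e : R) : 0 < e ->
  exists2 C : R, 0 <= C & forall th al p (L : R) n s,
    0 < L -> (1 < n)%N -> n%:R^-1 <= s <= 1 ->
    (1 <= n%:R * `|sin (th - al)| ->
       packing_bound (pdist th) (cl_set al p L n s) C e) /\
    (n%:R * `|sin (th - al)| < 1 ->
       packing_bound (pdist th) (cl_set al p L n s) C (Num.max s e)).
Proof.
move=> e0; have [C C0 hC] := @packing_bound_lacunary R (R * R)%type e e0.
(* The three constants belong to the flat, mid and steep points. *)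
exists (64 + 1 + C); first lra.
move=> th al p L n s L0 n1 sn.
have n0 : (0 < n)%N by exact: ltnW.
have cn := @cl_ratio_ge R n.
(* A steep projected height is at least 16 times the width of the Cantor coordinates, so the
   projected points are lacunary around the projection of [p]. *)
have steep : packing_bound (pdist th)
    (cl_pt al p L n s @` cl_steep al L n th) C e.
  apply: (hC _ p _ _ (fun k => cl_height L n k * `|sin (th - al)|)) => [|k|k|k [kn hk]].
  - exact: pseudometric_pdist.
  - by rewrite mulr_ge0// cl_height_ge0.
  - rewrite mulrA ler_wpM2r// -(cl_heightS L n k).
    apply: ler_wpM2r; [exact: cl_height_ge0|lra].
  rewrite pdist_cl_base.
  have h0 := cl_height_ge0 L n L0 k; have h1 := cl_shift_ge0 L n s L0 n0 sn k.
  have h2 := cl_shift_le L n s L0 n0 sn k kn.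
  have h3 : `|cl_shift L n s k * cos (th - al)| <= cl_shift L n s k.
    by rewrite normrM (ger0_norm h1) ler_piMr// cos_max.
  have h4 := ler_normD (cl_shift L n s k * cos (th - al))
    (cl_height L n k * sin (th - al)).
  have h5 := lerB_normD (cl_height L n k * sin (th - al))
    (cl_shift L n s k * cos (th - al)).
  rewrite [X in _ <= `|X|]addrC in h5.
  have h6 : `|cl_height L n k * sin (th - al)| = cl_height L n k * `|sin (th - al)|.
    by rewrite normrM (ger0_norm h0).
  rewrite h6 in h4 h5.
  by apply/andP; split; lra.
split=> hs.
  apply: (@packing_boundS _ _ _ _ C _ e) => //; first lra.
  by apply: packing_bound_sub steep; exact: cluster_steep.
have [sm em] : s <= Num.max s e /\ e <= Num.max s e by rewrite !le_max !lexx orbT.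
have s0 : 0 <= s.
  by case/andP: sn => h _; apply: le_trans h; rewrite invr_ge0 ler0n.
have sle : `|sin (th - al)| <= 1 / 2.
  have n2 : 2 <= n%:R :> R by rewrite ler_nat.
  have := ler_wpM2r (normr_ge0 (sin (th - al))) n2; lra.
apply: packing_bound_sub (cluster_split al p L n s th) _.
apply: packing_boundU; first apply: packing_boundU.
- have hf : packing_bound (pdist th) (cl_pt al p L n s @` cl_flat al L n th) 64 s.
    exact: packing_bound_flat.
  by apply: packing_boundS hf.
- have hm : packing_bound (pdist th) (cl_pt al p L n s @` cl_mid al L n th) 1 0.
    exact: packing_bound_mid.
  by apply: packing_boundS hm => //; exact: le_trans sm.
- by apply: packing_boundS steep.
Qed.

(** * Angles between lines *)

Section LineAngles.
Context {R : realType}.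
Implicit Types x y t e : R.

Lemma norm_sin_le x : `|sin x| <= `|x|.
Proof.
wlog x0 : x / 0 <= x => [hw|].
  have [/hw//|/ltW x0] := leP 0 x.
  by rewrite -(normrN x) -(normrN (sin x)) -sinN hw// oppr_ge0.
have [|c _] := @MVT_segment R sin cos 0 x x0 (fun t _ => is_derive_sin t).
  by apply: continuous_subspaceT => t; exact: continuous_sin.
rewrite sin0 !subr0 => ->; rewrite normrM ler_piMl//; exact: cos_max.
Qed.

(** Thus [|sin (x - y)|] depends only on the lines of angles [x] and [y]; it serves as the distance
    between them. *)
Lemma norm_sinDzpi (k : int) x : `|sin (x + k%:~R * pi)| = `|sin x|.
Proof.
have nat_case (m : nat) y : `|sin (y + m%:R * pi)| = `|sin y|.
  elim: m y => [|m IH] y; first by rewrite mul0r addr0.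
  by rewrite -natr1 mulrDl mul1r addrA sinDpi normrN IH.
case: k => m; first exact: nat_case.
by rewrite NegzE -(nat_case m.+1) rmorphN/= mulNr subrK.
Qed.

Lemma norm_sinD_le x y : `|sin (x + y)| <= `|sin x| + `|sin y|.
Proof.
rewrite sinD; apply: le_trans (ler_normD _ _) _; rewrite !normrM lerD//.
  by rewrite ler_piMr// cos_max.
by rewrite ler_piMl// cos_max.
Qed.

Lemma norm_sin_lt e x : 0 < e -> e <= pi / 2 -> `|sin x| < sin e ->
  exists k : int, `|x - k%:~R * pi| < e.
Proof.
move=> e0 epi sx; have p0 := @pi_gt0 R.
(* The integer nearest to [x / pi]: the remainder lies in [[- pi / 2, pi / 2]], where the sine is
   increasing. *)
pose k := Num.floor (x / pi + 1 / 2).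
have /andP[h1 h2] := floor_itv (x / pi + 1 / 2).
exists k; rewrite -/k in h1 h2.
have xE : x = x / pi * pi by rewrite divfK// gt_eqF.
have {}h1 : k%:~R * pi <= (x / pi + 1 / 2) * pi by rewrite ler_pM2r.
have {}h2 : (x / pi + 1 / 2) * pi < (k + 1)%:~R * pi by rewrite ltr_pM2r.
rewrite rmorphD /= mulr1z mulrDl mulrDl -xE mul1r in h1 h2.
rewrite -(norm_sinDzpi (- k)) rmorphN /= mulNr in sx.
set y := x - _ in sx *.
have yb : - (pi / 2) <= y <= pi / 2 by apply/andP; split; rewrite /y; lra.
have eI : e \in `[- (pi / 2), pi / 2] by rewrite in_itv /=; apply/andP; split; lra.
move: sx; rewrite ltNge => sx; rewrite ltNge; apply: contra sx => ye.
have -> : `|sin y| = `|sin `|y| |.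
  by have [_|_] := ger0P y; rewrite // sinN normrN.
have zI : `|y| \in `[- (pi / 2), pi / 2].
  rewrite in_itv /= ler_norml yb andbT; apply: le_trans (normr_ge0 _); lra.
by apply: le_trans (ler_norm _); rewrite leNgt ltr_sin// -leNgt.
Qed.

Lemma on_G12_zpi (phi : R -> R) (k : int) t :
  on_G12 phi -> phi (t + k%:~R * pi) = phi t.
Proof.
move=> hphi.
have nat_case (m : nat) y : phi (y + m%:R * pi) = phi y.
  elim: m y => [|m IH] y; first by rewrite mul0r addr0.
  by rewrite -natr1 mulrDl mul1r addrA hphi IH.
case: k => m; first exact: nat_case.
by rewrite NegzE -(nat_case m.+1 (_ + _)) rmorphN/= mulNr subrK.
Qed.

(** The bound 2 is for two directions that are each within [1 / n] of the same cluster angle. *)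
Lemma upper_semicont_sin (phi : R -> R) t e :
  on_G12 phi -> upper_semicont phi -> 0 < e ->
  exists N : nat, forall (n : nat) u, (N <= n)%N ->
    n%:R * `|sin (u - t)| < 2 -> phi u < phi t + e.
Proof.
move=> hphi usc e0; have /nbhs_ballP[d /= d0 hd] := usc t e e0.
have p0 := @pi_gt0 R.
pose d' := Num.min d (pi / 2).
have d'0 : 0 < d' by rewrite lt_min d0 divr_gt0.
have d'd : d' <= d by rewrite ge_min lexx.
have d'pi : d' <= pi / 2 by rewrite ge_min lexx orbT.
have s0 : 0 < sin d' by rewrite sin_gt0_pi//; apply/andP; split; lra.
exists (Num.bound (2 / sin d')) => n u Nn hu.
have h1 : 2 / sin d' < n%:R.
  apply: lt_le_trans (archi_boundP _) _; first by rewrite divr_ge0// ltW.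
  by rewrite ler_nat.
have [|k hk] := norm_sin_lt d' (u - t) d'0 d'pi.
  rewrite ltr_pdivrMr// in h1.
  have n0 : 0 < n%:R :> R by rewrite -(pmulr_lgt0 _ s0); lra.
  by rewrite -(ltr_pM2l n0); lra.
rewrite -(on_G12_zpi phi (- k) u hphi); apply: hd.
rewrite /ball /= distrC rmorphN /= mulNr addrAC; exact: lt_le_trans hk d'd.
Qed.

Lemma angle_net t e : 0 < e ->
  exists j : nat, (j < Num.bound (pi / e))%N /\ `|sin (t - j%:R * e)| <= e.
Proof.
move=> e0; have p0 := @pi_gt0 R.
pose k := Num.floor (t / pi).
have /andP[h1 h2] := floor_itv (t / pi); rewrite -/k in h1 h2.
have tE : t = t / pi * pi by rewrite divfK// gt_eqF.
have {}h1 : k%:~R * pi <= t / pi * pi by rewrite ler_pM2r.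
have {}h2 : t / pi * pi < (k + 1)%:~R * pi by rewrite ltr_pM2r.
rewrite -tE rmorphD /= mulr1z mulrDl mul1r in h1 h2.
pose y := t - k%:~R * pi.
have y0 : 0 <= y / e by apply: divr_ge0; [rewrite subr_ge0|exact: ltW].
have /andP[h3 h4] := truncn_itv y0.
rewrite ler_pdivlMr// in h3; rewrite ltr_pdivrMr// in h4.
exists (Num.truncn (y / e)); split.
  rewrite -(ltr_nat R); apply: lt_trans (archi_boundP _); last first.
    by rewrite divr_ge0// ltW.
  by rewrite ltr_pdivlMr//; rewrite /y in h3 *; lra.
rewrite -(norm_sinDzpi (- k)) rmorphN /= mulNr addrAC -/y.
apply: le_trans (norm_sin_le _) _; rewrite ger0_norm ?subr_ge0//.
by rewrite -natr1 mulrDl mul1r in h4; lra.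
Qed.

End LineAngles.

(** * The set *)

(* Enumerates, for every [m], a [w m.+1]-net of directions; only finitely many
   terms have a given value of [n], because the indices that do not code a point
   of a net get [n k = k.+1]. *)
Lemma direction_seq {R : realType} (w : nat -> R) : (forall m, 0 < w m) ->
  exists (n : nat -> nat) (al : nat -> R),
  [/\ forall k, (0 < n k)%N,
      forall N, exists K, forall k, (K <= k)%N -> (N <= n k)%N &
      forall t m, exists k, n k = m.+1 /\ `|sin (t - al k)| <= w m.+1].
Proof.
move=> w0; pose J m := Num.bound (pi / w m).
pose dec k : option (nat * nat) :=
  if pickle_inv k is Some mj then if (mj.2 < J mj.1.+1)%N then Some mj else None else None.
exists (fun k => if dec k is Some mj then mj.1.+1 else k.+1).
exists (fun k => if dec k is Some mj then mj.2%:R * w mj.1.+1 else 0).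
split=> [k|N|t m]; first by case: (dec k).
  (* Beyond the codes of all net points of level below [N], a coding index has a large level; the
     summand [N] handles the indices that code nothing. *)
  exists (N + (\max_(m < N) \max_(j < J m.+1) pickle (nat_of_ord m, nat_of_ord j)).+1)%N => k Kk.
  case dk: (dec k) => [[m j]|]; last first.
    by apply: leqW; apply: leq_trans Kk; rewrite leq_addr.
  rewrite leqNgt; apply/negP => /ltnW mN; rewrite /= in mN.
  have [kE jJ] : pickle (m, j) = k /\ (j < J m.+1)%N.
    move: dk (@pickle_invK (nat * nat)%type k); rewrite /dec.
    by case: pickle_inv => [mj|//] /=; case: ifP => // + [mjE]; rewrite mjE.
  have h1 := @leq_bigmax _ (fun j : 'I_(J m.+1) => pickle (m, nat_of_ord j)) (Ordinal jJ).
  have h2 := @leq_bigmax _ (fun m : 'I_N => \max_(j < J m.+1) pickle (nat_of_ord m, nat_of_ord j)) (Ordinal mN).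
  have := leq_trans h1 h2; rewrite /= kE leqNgt => /negP; apply.
  by apply: leq_trans Kk; rewrite addnS ltnS leq_addl.
have [j [jJ hj]] := angle_net t (w m.+1) (w0 _).
exists (pickle (m, j)); by rewrite /dec pickleK_inv /= jJ.
Qed.

Lemma cl_gap_mul_le {R : realType} n : (0 < n)%N -> 16 * (n%:R * cl_gap n) <= 1 :> R.
Proof.
move=> n0; have h1 := @cl_diam_ge1 R n.
have h2 := @cl_gap_le R n 0 n0 ltac:(by rewrite expn_gt0).
have h3 : 0 < n%:R * cl_gap n :> R by rewrite mulr_gt0 ?ltr0n ?cl_gap_gt0.
have h4 : n%:R * cl_gap n <= n%:R * cl_gap n * cl_diam n :> R.
  by rewrite ler_peMr// ltW.
by rewrite expr0 invr1 in h2; lra.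
Qed.

Lemma cluster_params {R : realType} (phi : R -> R) :
  on_G12 phi -> (forall t, 0 <= phi t <= 1) -> upper_semicont phi ->
  exists (n : nat -> nat) (al s : nat -> R),
  [/\ forall k, (0 < n k)%N /\ (n k)%:R^-1 <= s k <= 1,
      forall N, exists K, forall k, (K <= k)%N -> (N <= n k)%N,
      forall t e, 0 < e -> exists N, forall k, (N <= n k)%N ->
        (n k)%:R * `|sin (t - al k)| < 1 -> s k <= phi t + e &
      forall t m, exists k, [/\ n k = m.+1, phi t <= s k &
        8 * `|sin (t - al k)| <= cl_gap (n k)] ].
Proof.
move=> hphi phi01 usc.
(* [cl_gap 0] is 0, the inverse of 0 being 0, so the value 1 is put there to keep the widths
   positive. *)
have [|n [al [n0 n_oo n_net]]] := @direction_seq R (fun m => if m is 0%N then 1 else cl_gap m / 8).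
  by case=> // m; rewrite divr_gt0 ?cl_gap_gt0.
pose A k := phi @` [set u | (n k)%:R * `|sin (u - al k)| < 1].
(* The maximum with [1 / n k] secures the lower bound on [s] required of a cluster; it is harmless
   since [n k] tends to infinity. *)
pose s k := Num.max (n k)%:R^-1 (sup (A k)).
have A0 k : A k !=set0.
  by exists (phi (al k)), (al k) => //=; rewrite subrr sin0 normr0 mulr0.
have A1 k : ubound (A k) 1 by move=> _ [u _ <-]; case/andP: (phi01 u).
have phi_le k t : (n k)%:R * `|sin (t - al k)| < 1 -> phi t <= s k.
  move=> h; rewrite le_max; apply/orP; right; apply: ub_le_sup.
    by exists 1; exact: A1.
  by exists t.
exists n, al, s; split=> [k|//|t e e0|t m].
- split; first exact: n0.
  rewrite le_max lexx /= ge_max ge_sup// andbT.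
  by rewrite invf_le1 ?ltr0n// ler1n.
- have e20 : 0 < e / 2 by rewrite divr_gt0.
  have [N hN] := upper_semicont_sin phi t _ hphi usc e20.
  exists (maxn N (Num.bound (e^-1))) => k; rewrite geq_max => /andP[Nk ek] hk.
  rewrite ge_max; apply/andP; split.
    have := phi01 t => /andP[p0 _].
    have : (n k)%:R^-1 <= e.
      rewrite invf_ple ?posrE ?ltr0n//.
      apply: ltW; apply: lt_le_trans (archi_boundP _) _; first by rewrite invr_ge0 ltW.
      by rewrite ler_nat.
    by lra.
  apply: ge_sup => // _ [u hu <-].
  suff : phi u < phi t + e / 2 by lra.
  apply: (hN (n k)) => //.
  have -> : u - t = (u - al k) + - (t - al k) by ring.
  have := norm_sinD_le (u - al k) (- (t - al k)); rewrite sinN normrN => h.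
  apply: le_lt_trans (_ : (n k)%:R * (`|sin (u - al k)| + `|sin (t - al k)|) < _).
    by rewrite ler_wpM2l.
  by rewrite mulrDr; rewrite /= in hu; lra.
have [k [nk hk]] := n_net t m; exists k.
have g := @cl_gap_mul_le R _ (n0 k); rewrite nk in g *.
have h8 : 8 * `|sin (t - al k)| <= cl_gap m.+1 by lra.
split=> //; apply: phi_le; rewrite nk.
have : m.+1%:R * (8 * `|sin (t - al k)|) <= m.+1%:R * cl_gap m.+1 by rewrite ler_wpM2l.
by lra.
Qed.

(** * The union of the clusters: upper bounds and compactness *)

Section Union.
Context {R : realType}.
Notation P2 := (R * R)%type.
Notation edist := Defs.edist.

Definition base_x (k : nat) : R := 64^-1 ^+ k.+1.
Definition base_pt (k : nat) : P2 := (base_x k, base_x k ^+ 2).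
(** Of the order of the square of [base_x k], because that square is the distance from the origin to
    the projected base point in the worst direction, the vertical one. *)
Definition base_size (k : nat) : R := base_x k ^+ 2 / 16.

Lemma base_x_gt0 k : 0 < base_x k.
Proof. by rewrite exprn_gt0. Qed.

Lemma base_xS k : 64 * base_x k.+1 = base_x k.
Proof. by rewrite /base_x (exprS _ k.+1) mulVKf. Qed.

Lemma base_x_le k : 64 * base_x k <= 1.
Proof.
rewrite /base_x exprS mulVKf//; apply: exprn_ile1; lra.
Qed.

Lemma base_sq_le k : 64 * base_x k ^+ 2 <= base_x k.
Proof.
have := base_x_le k; have x0 := base_x_gt0 k.
by rewrite -(ler_pM2r x0) expr2; lra.
Qed.

Lemma base_size_gt0 k : 0 < base_size k.
Proof. by rewrite divr_gt0// exprn_gt0// base_x_gt0. Qed.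

Lemma base_x_small (e : R) : 0 < e -> exists K, forall k, (K <= k)%N -> base_x k <= e.
Proof.
move=> e0; exists (Num.bound e^-1) => k /upper_nthrootP h.
rewrite /base_x exprVn invf_ple ?posrE ?exprn_gt0//.
apply/ltW; apply: lt_le_trans h _.
apply: le_trans (_ : 64 ^+ k <= _); first by rewrite lerXn2r ?nnegrE; lra.
by rewrite exprS ler_peMl ?exprn_ge0//; lra.
Qed.

Variables (n : nat -> nat) (al s : nat -> R).
Hypothesis hns : forall k, (0 < n k)%N /\ (n k)%:R^-1 <= s k <= 1.

Definition part (k : nat) : set P2 :=
  cl_set (al k) (base_pt k) (base_size k) (n k) (s k).

Definition cluster_union : set P2 := [set (0, 0)] `|` \bigcup_k part k.

Lemma part_near k y : part k y -> 8 * edist (base_pt k) y <= base_x k ^+ 2.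
Proof.
have [n0 sn] := hns k.
move=> /(edist_cluster_le _ _ _ _ _ (base_size_gt0 k) n0 sn).
rewrite /base_size; lra.
Qed.

Lemma edist_base k : base_x k <= edist (0, 0) (base_pt k) <= base_x k + base_x k ^+ 2.
Proof.
have x0 := base_x_gt0 k; rewrite edistE /=.
have h1 := ler_normhypl (0 - base_x k) (0 - base_x k ^+ 2).
have h2 := hyp_le_norm (0 - base_x k) (0 - base_x k ^+ 2).
rewrite !sub0r !normrN (gtr0_norm x0) ger0_norm ?sqr_ge0// in h1 h2.
by rewrite !sub0r; apply/andP.
Qed.

Lemma edist_part k y : part k y -> base_x k / 2 <= edist (0, 0) y <= 2 * base_x k.
Proof.
move=> /part_near h; have [eC eT] := @pseudometric_edist R.
have h1 := eT (0, 0) (base_pt k) y; have h2 := eT (0, 0) y (base_pt k).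
rewrite (eC y) in h2.
have /andP[h3 h4] := edist_base k; have h5 := base_sq_le k.
have x0 := base_x_gt0 k.
by apply/andP; split; lra.
Qed.

Lemma packing_bound_union_edist (e : R) : 0 < e ->
  exists2 C : R, 0 <= C & packing_bound (@Defs.edist R) cluster_union C e.
Proof.
move=> e0; have e20 : 0 < e / 2 by rewrite divr_gt0.
have [C C0 hC] := @packing_bound_cluster_edist R (e / 2) e20.
have [C' C'0 hC'] := @packing_bound_annuli R P2 C (e / 2) (e / 2) C0 (ltW e20) e20.
exists (1 + C'); first by rewrite addr_ge0.
apply: packing_boundU.
  apply: (@packing_boundS _ _ _ _ 1 _ 0) => //; first exact: ltW.
  apply: packing_bound_sub (packing_bound_seq _ [:: (0, 0)]).
  by move=> y -> /=; rewrite mem_head.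
have -> : e = e / 2 + e / 2 by lra.
apply: (hC' _ (0, 0) _ base_x) => [|k|k|k y|k].
- exact: pseudometric_edist.
- exact/ltW/base_x_gt0.
- by have := base_xS k; have := base_x_gt0 k.+1; lra.
- exact: edist_part.
- by have [n0 sn] := hns k; apply: hC => //; exact: base_size_gt0.
Qed.

Lemma finite_parts K : exists S : seq P2,
  forall k y, (k < K)%N -> part k y -> y \in S.
Proof.
exists (flatten [seq [seq cl_pt (al k) (base_pt k) (base_size k) (n k) (s k) j |
   j <- iota 0 (2 ^ n k)] | k <- iota 0 K]) => k _ kK [j jn <-].
apply/flattenP; eexists; first by apply/mapP; exists k; rewrite ?mem_iota.
by apply/mapP; exists j => //; rewrite mem_iota.
Qed.

(* The base points lie on a parabola, so that in every direction their
   projections are eventually lacunary and far larger than the clusters. *)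
Lemma pdist_base t : exists K, forall k, (K <= k)%N ->
  16 * pdist t (0, 0) (base_pt k.+1) <= pdist t (0, 0) (base_pt k) /\
  base_x k ^+ 2 <= 4 * pdist t (0, 0) (base_pt k).
Proof.
have dE k : pdist t (0, 0) (base_pt k) = base_x k * `|cos t + base_x k * sin t|.
  have x0 := base_x_gt0 k.
  have -> z : base_x k * `|z| = `|base_x k * z| by rewrite normrM gtr0_norm.
  by rewrite /pdist /= !sub0r -normrN; congr `|_|; ring.
have [c0|c0] := eqVneq (cos t) 0.
  have s1 : `|sin t| = 1.
    by apply/eqP; rewrite norm_sin_eq1 c0.
  have {}dE k : pdist t (0, 0) (base_pt k) = base_x k ^+ 2.
    by rewrite dE c0 add0r normrM s1 mulr1 gtr0_norm ?base_x_gt0// expr2.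
  exists 0%N => k _; rewrite !dE -(base_xS k).
  by have := sqr_ge0 (base_x k.+1); split; lra.
have cp : 0 < `|cos t| by rewrite normr_gt0.
(* From [K] on, the quadratic coordinate perturbs the projection by at most half of its linear
   part. *)
have [|K hK] := @base_x_small (`|cos t| / 2); first by rewrite divr_gt0.
have bd k : (K <= k)%N ->
    base_x k * (`|cos t| / 2) <= pdist t (0, 0) (base_pt k) <=
    base_x k * (3 * `|cos t| / 2).
  move=> /hK hk; have x0 := base_x_gt0 k; rewrite dE !ler_pM2l//.
  have h1 := ler_normD (cos t) (base_x k * sin t).
  have h2 := lerB_normD (cos t) (base_x k * sin t).
  have h3 : `|base_x k * sin t| <= base_x k.
    by rewrite normrM (gtr0_norm x0) ler_piMr ?sin_max// ltW.
  by apply/andP; split; lra.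
exists K => k Kk; have /andP[h1 h2] := bd k Kk; have /andP[h3 h4] := bd k.+1 (leqW Kk).
have x0 := base_x_gt0 k; have hx := base_xS k.
have h5 : 64 * (base_x k.+1 * `|cos t|) = base_x k * `|cos t| by rewrite mulrA hx.
have h6 : 0 < base_x k * `|cos t| by rewrite mulr_gt0.
split; first lra.
have h7 : base_x k * base_x k <= base_x k * (`|cos t| / 2) by rewrite ler_pM2l// hK.
by rewrite expr2; lra.
Qed.

(** The first [K] clusters form a finite set, whose size may depend on [t]. The others are lacunary
    around the origin in direction [t], and each has exponent at most [v + e / 2], whether or not
    its Cantor set is seen from [t]. *)
Lemma packing_bound_union_pdist (t v : R) :
  (forall N, exists K, forall k, (K <= k)%N -> (N <= n k)%N) ->
  0 <= v ->
  (forall e, 0 < e -> exists N, forall k, (N <= n k)%N ->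
     (n k)%:R * `|sin (t - al k)| < 1 -> s k <= v + e) ->
  forall e, 0 < e ->
  exists2 C : R, 0 <= C & packing_bound (pdist t) cluster_union C (v + e).
Proof.
move=> n_oo v0 hv e e0; have e20 : 0 < e / 2 by rewrite divr_gt0.
have [C C0 hC] := @packing_bound_cluster_pdist R (e / 2) e20.
have ve0 : 0 <= v + e / 2 by rewrite addr_ge0// ltW.
have [C' C'0 hC'] := @packing_bound_annuli R P2 C (v + e / 2) (e / 2) C0 ve0 e20.
have [N hN] := hv _ e20.
have [K1 hK1] := n_oo (maxn 2 N); have [K2 hK2] := pdist_base t.
pose K := maxn K1 K2.
have [S hS] := finite_parts K.
exists ((size ((0, 0) :: S))%:R + C'); first by rewrite addr_ge0.
apply: (@packing_bound_sub _ _ _ _ ([set` (0, 0) :: S] `|` \bigcup_k part (K + k)%N)).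
  move=> y [->|[k _ ky]]; first by left; rewrite /= mem_head.
  have [kK|Kk] := ltnP k K; first by left; rewrite /= in_cons (hS k) ?orbT.
  by right; exists (k - K)%N => //; rewrite subnKC.
apply: packing_boundU.
  apply: packing_boundS (packing_bound_seq _ _) => //.
  by rewrite addr_ge0// ltW.
have -> : v + e = v + e / 2 + e / 2 by lra.
apply: (hC' _ (0, 0) _ (fun k => pdist t (0, 0) (base_pt (K + k)))) => [|k|k|k y ky|k].
- exact: pseudometric_pdist.
- exact: normr_ge0.
- have [h _] := hK2 (K + k)%N (leq_trans (leq_maxr _ _) (leq_addr _ _)).
  by rewrite addnS.
- have [_ h] := hK2 (K + k)%N (leq_trans (leq_maxr _ _) (leq_addr _ _)).
  have h1 := part_near _ _ ky; have h2 := pdist_le_edist t (base_pt (K + k)) y.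
  have [eC eT] := pseudometric_pdist t.
  have h3 := eT (0, 0) (base_pt (K + k)) y; have h4 := eT (0, 0) y (base_pt (K + k)).
  by rewrite (eC y) in h4; apply/andP; split; lra.
- have := hK1 (K + k)%N (leq_trans (leq_maxl _ _) (leq_addr _ _)).
  rewrite geq_max => /andP[n2 nN]; have [_ sn] := hns (K + k).
  have [h1 h2] := hC t (al (K + k)) (base_pt (K + k)) _ _ _ (base_size_gt0 (K + k)) n2 sn.
  have [ht|ht] := leP 1 ((n (K + k))%:R * `|sin (t - al (K + k))|).
    by apply: packing_boundS (h1 ht) => //; lra.
  apply: packing_boundS (h2 ht) => //.
  by rewrite ge_max hN//=; lra.
Qed.

(** Clusters shrink to the origin, so a filter that does not cluster there contains a finite subset
    of the union. *)
Lemma compact_cluster_union : compact cluster_union.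
Proof.
move=> G PG GF.
have [c0|] := pselect (cluster G (0, 0)); first by exists (0, 0); split=> //; left.
move=> /existsNP[A /existsNP[B /not_implyP[GA /not_implyP[/nbhs_ballP[d /= d0 dB] AB]]]].
have [|K hK] := @base_x_small (d / 4); first by rewrite divr_gt0.
have [S hS] := finite_parts K.
have far y : A y -> ~ ball ((0, 0) : R * R) d y.
  by move=> Ay /dB By; apply: AB; exists y.
have GS : G ([set` S] `&` cluster_union).
  apply: filterS (filterI GF GA) => y [[->|[k _ ky]] Ay].
    by have /far[] := Ay; exact: ballxx.
  split; last by right; exists k.
  apply: (hS k) => //; rewrite ltnNge; apply/negP => /hK hk.
  have /far[] := Ay.
  have /andP[_ h] := edist_part _ _ ky; rewrite edistE in h.
  have h1 := ler_normhypl ((0 : R) - y.1) (0 - y.2).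
  have h2 := ler_normhypr ((0 : R) - y.1) (0 - y.2).
  rewrite /= in h h1 h2 d0.
  by split; rewrite /ball /=; lra.
have [|y [[_ yF] Gy]] := finite_compact _ PG GS; last by exists y.
by apply: finite_setIl; exact: finite_seq.
Qed.

End Union.

(** * Lower bounds for the projections, and conclusion *)

Lemma exp2_dominates {R : realType} (A a : R) : 0 < A -> a < 1 ->
  exists m : nat, A * 2 `^ (m.+1%:R * a) < 2 ^+ m.+1.
Proof.
move=> A0 a1; have l0 : 0 < ln (2 : R) by rewrite ln_gt0//; lra.
have b0 : 0 < (1 - a) * ln 2 by rewrite mulr_gt0// subr_gt0.
pose m := Num.bound (A / ((1 - a) * ln 2)); exists m.
have hm : A / ((1 - a) * ln 2) < m.+1%:R.
  apply: lt_trans (archi_boundP _) _; first by rewrite divr_ge0// ltW.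
  by rewrite ltr_nat.
have -> : 2 ^+ m.+1 = 2 `^ (m.+1%:R * (1 - a)) * 2 `^ (m.+1%:R * a) :> R.
  rewrite -powRD; last by apply/implyP => _; rewrite gt_eqF.
  by rewrite -powR_mulrn//; congr (_ `^ _); ring.
rewrite ltr_pM2r ?powR_gt0// /powR ifF; last by apply/eqP; lra.
apply: lt_le_trans (expR_ge1Dx _).
by rewrite ltr_pdivrMr// in hm; lra.
Qed.

(** A cluster of level [m.+1] shows [2 ^ m.+1] separated points at ratio [16 * lam ^+ m.+1]. For
    [t < v <= s] the power [t] of this ratio is at most [16]^ t * 2 [^ (m.+1%:R * (t / v))], which
    [2 ^ m.+1] eventually beats by any constant factor. *)
Lemma assouad_dim_cl_set_ge {R : realType} (F : set (R * R)) (th v C u : R) :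
  0 <= u -> 0 <= C -> packing_bound (pdist th) F C u ->
  (forall m, exists al p L s, [/\ 0 < L, m.+1%:R^-1 <= s <= 1, v <= s,
     8 * `|sin (th - al)| <= cl_gap m.+1 & cl_set al p L m.+1 s `<=` F]) ->
  (v%:E <= assouad_dim (proj_line th F))%E.
Proof.
move=> u0 C0 hF hcl.
apply: (assouad_dim_ge _ C u) => //; first exact: packing_bound_proj.
move=> t C' t0 tv C'0; have v0 : 0 < v by exact: le_lt_trans tv.
have [||m hm] := @exp2_dominates R (C' * 16 `^ t) (t / v).
- by rewrite mulr_gt0// powR_gt0.
- by rewrite ltr_pdivrMr// mul1r.
have [al [p [L [s [L0 sn vs hsin FS]]]]] := hcl m.
have [S [Sn uS SF Sfar Snear]] :=
  cluster_effective al p L m.+1 s L0 (ltn0Sn m) sn th hsin.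
have s0 : 0 < s by exact: lt_le_trans vs.
have s01 : 0 < s <= 1 by rewrite s0; case/andP: sn.
set lam := 2 `^ s^-1 in Snear.
have lam2 : 2 <= lam by exact: spread_base_ge2.
have g0 : 0 < L * cl_gap m.+1 by rewrite mulr_gt0// cl_gap_gt0.
set tau := L * cl_gap m.+1 in Sfar Snear g0.
have l1 : 1 <= lam ^+ m.+1 by rewrite exprn_ege1//; lra.
have g1 : tau <= tau * lam ^+ m.+1 by rewrite ler_peMr// ltW.
have [y0 y0S] : exists y, y \in S.
  case: (S) Sn => [/= /eqP|y S' _]; first by rewrite eq_sym expn_eq0.
  by exists y; rewrite mem_head.
exists (tau / 8), (2 * tau * lam ^+ m.+1), (proj_pt th y0), (map (proj_pt th) S).
split; split.
- by rewrite divr_gt0.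
- by lra.
- by exists y0 => //; exact/FS/SF.
- rewrite map_inj_in_uniq// => y z yS zS yz; apply/eqP; apply: contraT => nyz.
  have := Sfar y z yS zS nyz; rewrite -edist_proj yz edistxx; lra.
- move=> _ /mapP[y yS ->]; split; first by exists y => //; exact/FS/SF.
  by rewrite edist_proj; exact: Snear.
- move=> _ _ /mapP[y yS ->] /mapP[z zS ->] nyz; rewrite edist_proj.
  by apply: Sfar => //; apply: contra nyz => /eqP ->.
- rewrite size_map Sn natrX; apply: le_lt_trans hm.
  have -> : 2 * tau * lam ^+ m.+1 / (tau / 8) = 16 * lam ^+ m.+1.
    by field; rewrite gt_eqF.
  have lp0 : 0 <= lam ^+ m.+1 by lra.
  rewrite powRM// mulrA ler_pM2l ?mulr_gt0 ?powR_gt0//.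
  rewrite -powR_mulrn; last lra.
  rewrite /lam -!powRrM; apply: ler_powR; first lra.
  rewrite mulrCA ler_wpM2l// mulrC ler_wpM2l//.
  by rewrite lef_pV2 ?posrE.
Qed.

Theorem theorem2p1 (R : realType) (phi : R -> R) :
  on_G12 phi ->
  (forall t, 0 <= phi t <= 1) ->
  upper_semicont phi ->
  exists F : set (R * R),
    compact F /\ F !=set0 /\ assouad_dim F = 0%E /\
    forall theta : R, assouad_dim (proj_line theta F) = (phi theta)%:E.
Proof.
move=> hphi phi01 usc.
have [n [al [s [hns n_oo s_usc s_net]]]] := cluster_params phi hphi phi01 usc.
exists (cluster_union n al s); split; first exact: compact_cluster_union.
split; first by exists (0, 0); left.
split=> [|th].
  apply/eqP; rewrite eq_le assouad_dim_ge0 andbT.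
  apply/lee_addgt0Pr => e e0; rewrite add0e.
  have [C C0 hC] := packing_bound_union_edist n al s hns e e0.
  by apply: (assouad_dim_le _ C) => //; exact: ltW.
have p0 : 0 <= phi th by case/andP: (phi01 th).
have hP := packing_bound_union_pdist n al s hns th (phi th) n_oo p0 (s_usc th).
apply/eqP; rewrite eq_le; apply/andP; split.
  apply/lee_addgt0Pr => e e0; rewrite -EFinD.
  have [C C0 hC] := hP e e0.
  apply: (assouad_dim_le _ C) => //; first by rewrite addr_ge0// ltW.
  exact: packing_bound_proj.
(* Any exponent will do here: the packing bound only ensures finite covers. *)
have [C C0 hC] := hP 1 ltr01.
apply: (assouad_dim_cl_set_ge _ _ _ C (phi th + 1)) => //; first by rewrite addr_ge0.
move=> m; have [k [nk ps hk]] := s_net th m.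
have [_ sn] := hns k; rewrite nk in hk sn.
exists (al k), (base_pt k), (base_size k), (s k); split=> //.
  exact: base_size_gt0.
by move=> y ky; right; exists k => //; rewrite /part nk.
Qed.
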